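(* Let $(N,g,J)$ be a locally metallic Riemannian manifold, with $\nabla$ the Levi-Civita connection of $g$, and let $f:\mathbb{R}\to(0,\infty)$ be a smooth function. Then the warped product $\mathbb{R}\times_f N$, i.e. $\mathbb{R}\times N$ with the metric $\langle\,,\rangle=dt^2+f(t)^2 g$, endowed with $\xi=\partial/\partial t$, $\eta=dt$ and the $(1,1)$-tensor field $\phi$ given by $\phi\tilde X=JX$ for $\tilde X=\eta(\tilde X)\xi+X$ with $X$ tangent to $N$, is a $\left(-\frac{f'}{f},\phi\right)$-Kenmotsu quadratic metric manifold.
   Context: A metallic structure on a manifold $N$ is a $(1,1)$-tensor field $J$ with $J^2=pJ+qI$, where $p,q$ are positive integers. $(N,g,J)$ is a metallic Riemannian manifold if moreover $g$ is a Riemannian metric with $g(JX,Y)=g(X,JY)$ for all vector fields $X,Y$; it is locally metallic if in addition $\nabla J=0$ for the Levi-Civita connection $\nabla$ of $g$. An almost quadratic $\phi$-structure $(\phi,\eta,\xi)$ on a manifold $M$ consists of a $(1,1)$-tensor field $\phi$, a unit (in particular nowhere vanishing) vector field $\xi$ and a $1$-form $\eta$ with $\phi\xi=0$ and $\phi^2=a\phi+b(I-\eta\otimes\xi)$, where $a$ is an arbitrary real constant, $b$ is a nonzero real constant and $a^2+4b\neq0$ (one then has $\eta(\xi)=1$ and $\eta\circ\phi=0$). If $M$ has a Riemannian metric $g$ with $g(\phi X,Y)=g(X,\phi Y)$ for all $X,Y$ (compatibility, taken in the paper as equivalent to $g(\phi X,\phi Y)=a\,g(\phi X,Y)+b(g(X,Y)-\eta(X)\eta(Y))$),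 then $(g,\phi,\eta,\xi)$ is an almost quadratic metric $\phi$-structure and $M$ an almost quadratic metric $\phi$-manifold. An almost quadratic metric $\phi$-manifold $(M,g,\nabla,\phi,\xi,\eta)$, with $\nabla$ the Levi-Civita connection of $g$, is called a $(\beta,\phi)$-Kenmotsu quadratic metric manifold, $\beta\in C^\infty(M)$, if $(\nabla_X\phi)Y=\beta\{g(X,\phi Y)\xi+\eta(Y)\phi X\}$ for all vector fields $X,Y$ on $M$. The function $-f'/f$ of $t$ is regarded as a function on $\mathbb{R}\times N$ via projection. *)

(* Defs.v *)
From HB Require Import structures.
From mathcomp Require Import all_boot all_order all_algebra.
From mathcomp Require Import all_classical all_reals all_analysis.

Set Implicit Arguments.
Unset Strict Implicit.
Unset Printing Implicit Defensive.

Import Order.TTheory GRing.Theory Num.Theory.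
Import numFieldNormedType.Exports.

Local Open Scope classical_set_scope.
Local Open Scope ring_scope.

(* [Ck k U f] is meant for U open and V finite dimensional: f is C^0 if it is
   continuous, and C^(k+1) if it is differentiable with C^k directional
   derivatives. *)
Fixpoint Ck (R : realType) (V W : normedModType R) (k : nat) (U : set V)
    (f : V -> W) : Prop :=
  match k with
  | 0 => forall x, U x -> {for x, continuous f}
  | k'.+1 => (forall x, U x -> differentiable f x) /\
             forall v : V, Ck k' U ('D_v f)
  end.

Definition smooth (R : realType) (V W : normedModType R) (U : set V)
  (f : V -> W) : Prop := forall k, Ck k U f.

(* [c_map] and [c_inv] are total functions; their values outside [c_dom] and
   [c_img] are irrelevant. *)
Record chart (R : realType) (T : topologicalType) (n : nat) := Chart {
  c_dom : set T;
  c_img : set 'rV[R]_n;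
  c_map :> T -> 'rV[R]_n;
  c_inv : 'rV[R]_n -> T;
  c_dom_open : open c_dom;
  c_img_open : open c_img;
  c_mapP : forall p, c_dom p -> c_img (c_map p);
  c_invP : forall y, c_img y -> c_dom (c_inv y);
  c_mapK : forall p, c_dom p -> c_inv (c_map p) = p;
  c_invK : forall y, c_img y -> c_map (c_inv y) = y;
  c_map_continuous : forall p, c_dom p -> {for p, continuous c_map};
  c_inv_continuous : forall y, c_img y -> {for y, continuous c_inv} }.

Arguments c_img_open [R T n] c t _.
Arguments c_map_continuous [R T n] c [p] _ t _.
Arguments c_inv_continuous [R T n] c [y] _ t _.

(* The part of the image of a chart that corresponds to the points of U. *)
Definition c_set (R : realType) (T : topologicalType) (n : nat)
    (c : chart R T n) (U : set T) : set 'rV[R]_n :=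
  c_img c `&` c_inv c @^-1` U.

Record manifold (R : realType) (n : nat) := Manifold {
  carrier :> topologicalType;
  hausdorffM : hausdorff_space carrier;
  second_countableM : @second_countable carrier;
  atlas : set (chart R carrier n);
  chart_at : carrier -> chart R carrier n;
  chart_at_atlas : forall p, atlas (chart_at p);
  chart_at_dom : forall p, c_dom (chart_at p) p;
  atlas_smooth : forall c c', atlas c -> atlas c' ->
    smooth (c_set c (c_dom c')) (c' \o c_inv c) }.

Arguments atlas {R n} m.
Arguments hausdorffM [R n] m p q _.

Section Fields.
Variables (R : realType) (n : nat) (M : manifold R n).

(* A tangent vector at p is represented by its components in the preferred
   chart [chart_at p]: each tangent space T_p M is the vector space 'rV_n. *)
Definition vfield : Type := M -> 'rV[R]_n.


Definition vderiv (W : normedModType R) (p : M) (v : 'rV[R]_n) (h : M -> W) : W :=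
  'D_v (h \o c_inv (chart_at p)) (chart_at p p).

Definition smooth_fun (U : set M) (h : M -> R) : Prop :=
  forall c, atlas M c -> smooth (c_set c U) (h \o c_inv c).

(* [vderiv p v c] is the row of components of v in an arbitrary chart c. *)
Definition smooth_vfield (U : set M) (X : vfield) : Prop :=
  forall c, atlas M c ->
    smooth (c_set c U) ((fun p => vderiv p (X p) c) \o c_inv c).

(* Tensor fields are given pointwise; they are smooth when their values on
   smooth vector fields, defined on an arbitrary open set, are smooth. *)
Definition one_form (eta : M -> 'rV[R]_n -> R) : Prop :=
  (forall p, scalar (eta p)) /\
  forall U (X : vfield), open U -> smooth_vfield U X ->
    smooth_fun U (fun p => eta p (X p)).

Definition tensor11 (J : M -> 'rV[R]_n -> 'rV[R]_n) : Prop :=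
  (forall p, linear (J p)) /\
  forall U (X : vfield), open U -> smooth_vfield U X ->
    smooth_vfield U (fun p => J p (X p)).

Definition riemannian_metric (g : M -> 'rV[R]_n -> 'rV[R]_n -> R) : Prop :=
  [/\ forall p u, scalar (g p u),
      forall p u v, g p u v = g p v u,
      forall p u, u != 0 -> 0 < g p u u &
      forall U (X Y : vfield), open U -> smooth_vfield U X ->
        smooth_vfield U Y -> smooth_fun U (fun p => g p (X p) (Y p))].

(* Connections act on the vector fields that are smooth on some open set U, a
   field on U being extended to M by arbitrary values; the values of
   [nabla X Y] are constrained only at the points near which X and Y are
   smooth.  The case U = setT is that of globally defined vector fields. *)
Definition connection (nabla : vfield -> vfield -> vfield) : Prop :=
  forall U, open U ->
  [/\ forall X Y, smooth_vfield U X -> smooth_vfield U Y ->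
        smooth_vfield U (nabla X Y),
      forall X X' Y h, smooth_vfield U X -> smooth_vfield U X' ->
        smooth_vfield U Y -> smooth_fun U h -> forall p, U p ->
        nabla (fun p => h p *: X p + X' p) Y p
          = h p *: nabla X Y p + nabla X' Y p,
      forall X Y Y', smooth_vfield U X -> smooth_vfield U Y ->
        smooth_vfield U Y' -> forall p, U p ->
        nabla X (fun p => Y p + Y' p) p = nabla X Y p + nabla X Y' p &
      forall X Y h, smooth_vfield U X -> smooth_vfield U Y ->
        smooth_fun U h -> forall p, U p ->
        nabla X (fun p => h p *: Y p) p
          = vderiv p (X p) h *: Y p + h p *: nabla X Y p].

(* nabla_X Y - nabla_Y X = [X, Y], both sides being compared as derivations. *)
Definition torsion_free (nabla : vfield -> vfield -> vfield) : Prop :=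
  forall U (X Y : vfield) h, open U -> smooth_vfield U X -> smooth_vfield U Y ->
    smooth_fun U h -> forall p : M, U p ->
    vderiv p (nabla X Y p - nabla Y X p) h
      = vderiv p (X p) (fun p' => vderiv p' (Y p') h)
        - vderiv p (Y p) (fun p' => vderiv p' (X p') h).

Definition metric_connection (g : M -> 'rV[R]_n -> 'rV[R]_n -> R)
    (nabla : vfield -> vfield -> vfield) : Prop :=
  forall U (X Y Z : vfield), open U -> smooth_vfield U X ->
    smooth_vfield U Y -> smooth_vfield U Z -> forall p : M, U p ->
    vderiv p (X p) (fun p' => g p' (Y p') (Z p'))
      = g p (nabla X Y p) (Z p) + g p (Y p) (nabla X Z p).

Definition levi_civita (g : M -> 'rV[R]_n -> 'rV[R]_n -> R)
    (nabla : vfield -> vfield -> vfield) : Prop :=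
  [/\ connection nabla, torsion_free nabla & metric_connection g nabla].

(* (nabla_X J) Y *)
Definition cov_deriv11 (nabla : vfield -> vfield -> vfield)
    (J : M -> 'rV[R]_n -> 'rV[R]_n) (X Y : vfield) : vfield :=
  fun p => nabla X (fun p' => J p' (Y p')) p - J p (nabla X Y p).

Definition compatible (g : M -> 'rV[R]_n -> 'rV[R]_n -> R)
    (J : M -> 'rV[R]_n -> 'rV[R]_n) : Prop :=
  forall p u v, g p (J p u) v = g p u (J p v).

Definition metallic_structure (J : M -> 'rV[R]_n -> 'rV[R]_n) : Prop :=
  tensor11 J /\
  exists p q : nat, [/\ (0 < p)%N, (0 < q)%N &
    forall x v, J x (J x v) = p%:R *: J x v + q%:R *: v].

Definition metallic_riemannian (g : M -> 'rV[R]_n -> 'rV[R]_n -> R)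
    (J : M -> 'rV[R]_n -> 'rV[R]_n) : Prop :=
  [/\ riemannian_metric g, metallic_structure J & compatible g J].

Definition locally_metallic (g : M -> 'rV[R]_n -> 'rV[R]_n -> R)
    (J : M -> 'rV[R]_n -> 'rV[R]_n) (nabla : vfield -> vfield -> vfield) : Prop :=
  [/\ metallic_riemannian g J, levi_civita g nabla &
      forall U (X Y : vfield), open U -> smooth_vfield U X ->
        smooth_vfield U Y -> forall p, U p -> cov_deriv11 nabla J X Y p = 0].

Definition almost_quadratic_metric (g : M -> 'rV[R]_n -> 'rV[R]_n -> R)
    (phi : M -> 'rV[R]_n -> 'rV[R]_n) (xi : vfield)
    (eta : M -> 'rV[R]_n -> R) : Prop :=
  [/\ riemannian_metric g,
      [/\ tensor11 phi, smooth_vfield setT xi & one_form eta],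
      forall p, g p (xi p) (xi p) = 1 /\ phi p (xi p) = 0,
      exists a b : R, [/\ b != 0, a ^+ 2 + 4 * b != 0 &
        forall p u, phi p (phi p u) = a *: phi p u + b *: (u - eta p u *: xi p)] &
      compatible g phi].

Definition kenmotsu_quadratic_metric (g : M -> 'rV[R]_n -> 'rV[R]_n -> R)
    (nabla : vfield -> vfield -> vfield)
    (phi : M -> 'rV[R]_n -> 'rV[R]_n) (xi : vfield)
    (eta : M -> 'rV[R]_n -> R) (beta : M -> R) : Prop :=
  [/\ almost_quadratic_metric g phi xi eta, levi_civita g nabla,
      smooth_fun setT beta &
      forall U (X Y : vfield), open U -> smooth_vfield U X ->
        smooth_vfield U Y -> forall p, U p ->
        cov_deriv11 nabla phi X Y p
          = beta p *: (g p (X p) (phi p (Y p)) *: xi p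
                       + eta p (Y p) *: phi p (X p))].

End Fields.

Section CkTheory.
Variable R : realType.
Implicit Types U V W : normedModType R.

Lemma near_eq_differentiable V W (f g : V -> W) (x : V) :
  (\near x, f x = g x) -> differentiable f x -> differentiable g x.
Proof.
move=> fg df; have [cdf fE] := (diff_locallyP x f).1 df.
have gE : g \o shift x = cst (g x) + 'd f x +o_ 0 id.
  apply/eqaddoP => e e0; rewrite -(nbhs_singleton fg).
  have := (eqaddoP _ _ _ _).1 fE e e0.
  have fgs : \forall h \near (0 : V), f (h + x) = g (h + x).
    by move: fg; rewrite (near_shift 0 x) subr0.
  by apply: filterS2 fgs => h fgh; rewrite /= !fctE /= /shift /= fgh.
apply/diff_locallyP; suff -> : 'd g x = 'd f x :> (V -> W) by split.
exact: diff_unique.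
Qed.

Lemma Ck_ext V W k (A : set V) (f g : V -> W) : open A ->
  (forall x, A x -> f x = g x) -> Ck k A f -> Ck k A g.
Proof.
move=> oA; have near_fg (h h' : V -> W) x : A x ->
    (forall x, A x -> h x = h' x) -> \near x, h x = h' x.
  by move=> Ax hh'; apply: filterS (open_nbhs_nbhs (conj oA Ax)) => z /hh'.
elim: k f g => [|k IH] f g fg /= Cf.
  move=> x Ax; have fgx := near_fg _ _ _ Ax fg.
  rewrite /prop_for /continuous_at -(fg x Ax).
  by apply: cvg_trans (Cf x Ax); exact: near_eq_cvg.
case: Cf => df Cf; split=> [x Ax|v].
  by apply: near_eq_differentiable (df x Ax); exact: near_fg.
apply: IH (Cf v) => x Ax; apply: near_eq_derive; exact: near_fg.
Qed.

Lemma CkD V W k (A : set V) (f g : V -> W) : open A ->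
  Ck k A f -> Ck k A g -> Ck k A (fun x => f x + g x).
Proof.
move=> oA; elim: k f g => [|k IH] f g /= Cf Cg.
  by move=> x Ax; apply: continuousD; [exact: Cf|exact: Cg].
case: Cf Cg => df Cf [dg Cg]; split=> [x Ax|v].
  by apply: differentiableD; [exact: df|exact: dg].
apply: Ck_ext (IH _ _ (Cf v) (Cg v)) => // x Ax.
by rewrite -deriveD//; apply: diff_derivable; [exact: df|exact: dg].
Qed.

Lemma Ck_cst V W k (A : set V) (w : W) : open A -> Ck k A (cst w).
Proof.
move=> oA; elim: k w => [|k IH] w /=; first by move=> x _; exact: cst_continuous.
split=> [x _|v]; first exact: differentiable_cst.
by apply: Ck_ext (IH 0) => // x _; rewrite derive_cst.
Qed.

Lemma Ck_lin V W k (A : set V) (L : {linear V -> W}) : open A ->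
  continuous L -> Ck k A L.
Proof.
move=> oA cL; case: k => [|k] /=; first by move=> x _; exact: cL.
split=> [x _|v]; first exact: linear_differentiable.
apply: Ck_ext (Ck_cst k (L v) oA) => // x _.
by rewrite deriveE ?diff_lin//; exact: linear_differentiable.
Qed.

Lemma Ck_conj U V W (W' : normedModType R) k (A : set V) (L : {linear U -> V})
    (B : {linear W -> W'}) (f : V -> W) : open A ->
  continuous L -> continuous B -> Ck k A f ->
  Ck k (L @^-1` A) (B \o f \o L).
Proof.
move=> oA cL cB; have oLA : open (L @^-1` A) by exact: open_comp (fun x _ => cL x) oA.
elim: k f => [|k IH] f /= Cf.
  move=> x Ax; apply: continuous_comp; first exact: cL.
  by apply: continuous_comp; [exact: Cf|exact: cB].
case: Cf => df Cf; split=> [x Ax|v].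
  apply: differentiable_comp; first exact: linear_differentiable.
  by apply: differentiable_comp; [exact: df|exact: linear_differentiable].
apply: Ck_ext (IH _ (Cf (L v))) => // x Ax /=.
have dL : differentiable L x by exact: linear_differentiable.
have dB y : differentiable B y by exact: linear_differentiable.
have dfx := df _ Ax.
have dBf : differentiable (B \o f) (L x) by exact: differentiable_comp.
rewrite [RHS]deriveE; last exact: differentiable_comp.
rewrite diff_comp// [in RHS]/comp diff_comp// [in RHS]/comp.
by rewrite (diff_lin _ cL) (diff_lin _ cB) deriveE.
Qed.

Lemma continuous_mx (T : topologicalType) m n (F : T -> 'M[R]_(m, n)) (x : T) :
  (forall i j, {for x, continuous (fun y => F y i j)}) -> {for x, continuous F}.
Proof.
move=> cF A [P PM sPA].
have : \forall y \near x, forall i j, P i j (F y i j).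
  apply: filter_forall => i; apply: filter_forall => j.
  exact: cF i j _ (PM i j).
by apply: filterS => y /sPA.
Qed.

Lemma continuous_mulmxr m n p (B : 'M[R]_(n, p)) :
  continuous (mulmxr B : 'M[R]_(m, n) -> 'M[R]_(m, p)).
Proof.
move=> x; apply: continuous_mx => i j.
have -> : (fun y : 'M[R]_(m, n) => mulmxr B y i j) =
    (fun y => \sum_k y i k * B k j).
  by apply/funext => y; rewrite /= mxE.
suff /(_ x) : continuous (fun y : 'M[R]_(m, n) => \sum_k y i k * B k j) by [].
apply: continuous_big => [|k _ y]; first exact: add_continuous.
have cy : {for y, continuous (fun y : 'M[R]_(m, n) => y i k)}.
  exact: coord_continuous.
exact: (continuousM cy (@cst_continuous _ _ (B k j) _ )).
Qed.

Lemma c_set_open (T : topologicalType) n (c : chart R T n) (U : set T) :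
  open U -> open (c_set c U).
Proof.
move=> oU; rewrite openE => y [cy Uy]; rewrite /interior.
have oc := c_img_open c.
apply: filterI; first exact: open_nbhs_nbhs (conj oc cy).
by apply: (c_inv_continuous c cy); exact: open_nbhs_nbhs (conj oU Uy).
Qed.

End CkTheory.

Section Cylinder.
Variables (R : realType) (n : nat) (N : manifold R n).

(* A chart c of N gives the chart (t, x) |-> (t, c x) of R x N. *)
Section CylinderChart.
Variable c : chart R N n.

Definition cyl_map (p : R * N) : 'rV[R]_(1 + n) := row_mx p.1%:M (c p.2).

Definition cyl_inv (y : 'rV[R]_(1 + n)) : R * N :=
  (lsubmx y 0 0, c_inv c (rsubmx y)).

Let cdom : set (R * N) := [set p | c_dom c p.2].
Let cimg : set 'rV[R]_(1 + n) := [set y | c_img c (rsubmx y)].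

Lemma cyl_dom_open : open cdom.
Proof. by apply: (open_comp (f := snd) _ (c_dom_open c)) => p _; exact: cvg_snd. Qed.

Lemma cyl_img_open : open cimg.
Proof.
by apply: (@open_comp _ _ (@rsubmx R 1 1 n) (c_img c) _ (c_img_open c)) => p _;
  exact: continuous_rsubmx.
Qed.

Lemma cyl_mapP p : cdom p -> cimg (cyl_map p).
Proof. by move=> cp; rewrite /cimg/= row_mxKr; exact: c_mapP. Qed.

Lemma cyl_invP y : cimg y -> cdom (cyl_inv y).
Proof. exact: c_invP. Qed.

Lemma cyl_mapK p : cdom p -> cyl_inv (cyl_map p) = p.
Proof.
case: p => t x cx; rewrite /cyl_inv /cyl_map row_mxKl row_mxKr /=.
by rewrite c_mapK// mxE mulr1n.
Qed.

Lemma cyl_invK y : cimg y -> cyl_map (cyl_inv y) = y.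
Proof. by move=> cy; rewrite /cyl_map /= c_invK// -mx11_scalar hsubmxK. Qed.

Lemma cyl_map_continuous p : cdom p -> {for p, continuous cyl_map}.
Proof.
move=> cp; apply: continuous_mx => i j.
case: (split_ordP j) => k ->.
  have -> : (fun q => cyl_map q i (lshift n k)) = fst.
    by apply/funext => q; rewrite row_mxEl !ord1 mxE mulr1n.
  exact: cvg_fst.
have -> : (fun q => cyl_map q i (rshift 1 k)) =
    (fun y : 'rV[R]_n => y i k) \o c \o snd.
  by apply/funext => q; rewrite row_mxEr.
apply: continuous_comp; first exact: cvg_snd.
by apply: continuous_comp; [exact: c_map_continuous|exact: coord_continuous].
Qed.

Lemma cyl_inv_continuous y : cimg y -> {for y, continuous cyl_inv}.
Proof.
move=> cy.
have c1 : {for y, continuous (fun y : 'rV[R]_(1 + n) => lsubmx y 0 0)}.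
  exact: (@continuous_comp _ _ _ (@lsubmx R 1 1 n) (fun z => z 0 0) y
    (@continuous_lsubmx R 1 1 n y) (@coord_continuous _ _ _ _ _ _)).
have c2 : {for y, continuous (c_inv c \o @rsubmx R 1 1 n)}.
  apply: continuous_comp; first exact: continuous_rsubmx.
  exact: (c_inv_continuous c cy).
exact: (cvg_pair c1 c2).
Qed.

Definition cyl_chart : chart R (R * N)%type (1 + n) :=
  Chart cyl_dom_open cyl_img_open cyl_mapP cyl_invP cyl_mapK cyl_invK
    cyl_map_continuous cyl_inv_continuous.

End CylinderChart.

Lemma cyl_hausdorff : hausdorff_space (R * N)%type.
Proof.
rewrite open_hausdorff => -[t x] [s y] /=.
have hR := @norm_hausdorff R R^o; rewrite open_hausdorff in hR.
have hN := hausdorffM N; rewrite open_hausdorff in hN.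
have [->|ts _] := eqVneq t s.
  have [->|xy _] := eqVneq x y; first by rewrite eqxx.
  have [[A B] /= [/set_mem Ax /set_mem By] [oA oB /eqP AB]] := hN _ _ xy.
  exists (snd @^-1` A, snd @^-1` B) => /=; first by split; exact/mem_set.
  split; try (by apply: open_comp => // p _; exact: cvg_snd).
  by rewrite -preimage_setI AB preimage_set0.
have [[A B] /= [/set_mem Ax /set_mem By] [oA oB /eqP AB]] := hR _ _ ts.
exists (fst @^-1` A, fst @^-1` B) => /=; first by split; exact/mem_set.
split; try (by apply: open_comp => // p _; exact: cvg_fst).
by rewrite -preimage_setI AB preimage_set0.
Qed.

Lemma cyl_second_countable : @second_countable (R * N)%type.
Proof.
have [B cB [oB bB]] := second_countableM N.
pose I (q : rat * rat) : set R := ball (ratr q.1 : R) (ratr q.2 : R).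
exists ((fun P : (rat * rat) * set N => I P.1 `*` P.2) @` ([set: rat * rat] `*` B)).
  apply: sub_countable (card_image_le _ _) _.
  by apply: countableX => //; exact: countableP.
split=> [_ [[q C] /= [_ BC] <-]|[t x] V [[P Q] /= [Pt Qx] PQV]].
  have oI : open (I q) by exact: ball_open.
  apply: (@openI _ (fst @^-1` I q) (snd @^-1` C)).
    by apply: open_comp oI => p _; exact: cvg_fst.
  by apply: open_comp (oB _ BC) => p _; exact: cvg_snd.
have [c [r [It IP]]] := open_subball_rat (open_interior P) (mem_set Pt).
have [C [BC Cx] CQ] := bB x Q Qx.
exists (I (c, r) `*` C); last first.
  by move=> [s y] /= [Is Cy]; apply: PQV; split; [exact: interior_subset (IP _ Is)|exact: CQ].
split; last by split => //; exact/set_mem.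
by exists ((c, r), C).
Qed.

Lemma cyl_atlas_smooth (c c' : chart R N n) : atlas N c -> atlas N c' ->
  smooth (c_set (cyl_chart c) (c_dom (cyl_chart c')))
         (cyl_chart c' \o c_inv (cyl_chart c)).
Proof.
move=> ac ac' k; pose A := c_set c (c_dom c').
have oA : open A by exact: c_set_open (c_dom_open c').
have crs : continuous (@rsubmx R 1 1 n) by exact: continuous_rsubmx.
have oLA : open (@rsubmx R 1 1 n @^-1` A) by exact: open_comp (fun x _ => crs x) oA.
pose J1 : 'M[R]_(1, 1 + n) := row_mx 1%:M 0.
pose J2 : 'M[R]_(n, 1 + n) := row_mx 0 1%:M.
have C2 := Ck_conj (B := mulmxr J2) oA crs (@continuous_mulmxr _ _ _ _ J2)
  (atlas_smooth ac ac' k).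
have cL : continuous (mulmxr J1 \o @lsubmx R 1 1 n).
  move=> y; apply: continuous_comp; first exact: continuous_lsubmx.
  exact: continuous_mulmxr.
have C1 := Ck_lin k oLA cL.
apply: Ck_ext (CkD oLA C1 C2) => // y _ /=.
rewrite /cyl_map /cyl_inv /= !mul_mx_row !mulmx1 !mulmx0 add_row_mx addr0 add0r.
by rewrite -mx11_scalar.
Qed.

Lemma cyl_atlas (c c' : chart R (R * N)%type (1 + n)) :
  (cyl_chart @` atlas N) c -> (cyl_chart @` atlas N) c' ->
  smooth (c_set c (c_dom c')) (c' \o c_inv c).
Proof. by move=> [d ad <-] [d' ad' <-]; exact: cyl_atlas_smooth. Qed.

(* The product manifold R x N.  Its preferred chart at (t, x) comes from the
   preferred chart of N at x, so that [row_mx] identifies R x T_x N with the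
   tangent space of R x N at (t, x). *)
Definition cylinder : manifold R (1 + n) :=
  @Manifold R (1 + n) (R * N)%type cyl_hausdorff cyl_second_countable
    (cyl_chart @` atlas N) (fun p => cyl_chart (chart_at p.2))
    (fun p => imageP cyl_chart (chart_at_atlas p.2))
    (fun p => chart_at_dom p.2) cyl_atlas.

(* d/dt and dt in the coordinates (t, x); see [vderiv_xi] and [cyl_etaE]. *)
Definition cyl_xi : vfield cylinder := fun=> row_mx 1%:M 0.
Definition cyl_eta (p : cylinder) (u : 'rV[R]_(1 + n)) : R := lsubmx u 0 0.

Lemma vderiv_xi (W : normedModType R) (h : cylinder -> W) (p : cylinder) :
  vderiv p (cyl_xi p) h = derive1 (fun s : R => h (s, p.2)) p.1.
Proof.
case: p => t x; have cx := chart_at_dom x.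
have E s : cyl_inv (chart_at x) (s *: cyl_xi (t, x) + cyl_map (chart_at x) (t, x))
    = (s + t, x).
  rewrite /cyl_inv /cyl_xi /cyl_map scale_row_mx add_row_mx row_mxKl row_mxKr.
  by rewrite scaler0 add0r /= c_mapK// !mxE !mulr1n mulr1.
have E0 : cyl_inv (chart_at x) (cyl_map (chart_at x) (t, x)) = (t, x).
  by rewrite cyl_mapK.
rewrite /vderiv /derive /derive1.
suff -> : (fun s : R => s^-1 *: (((h \o c_inv (chart_at ((t, x) : cylinder)))
    \o shift (cyl_map (chart_at x) (t, x))) (s *: cyl_xi (t, x)) -
    (h \o cyl_inv (chart_at x)) (cyl_map (chart_at x) (t, x))))
  = (fun s => s^-1 *: (h (s + t, x) - h (t, x))) by [].
by apply: funext => s; rewrite /shift /= E E0.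
Qed.

Lemma cyl_etaE (p : cylinder) (u : 'rV[R]_(1 + n)) :
  cyl_eta p u = vderiv p u (fst : cylinder -> R).
Proof.
rewrite /vderiv /cyl_eta.
have lE : (fst : cylinder -> R) \o c_inv (chart_at p) =
    (fun y : 'rV[R]_(1 + n) => y 0 (lshift n 0)).
  by apply/funext => y; rewrite /= mxE.
have @l : {linear 'rV[R]_(1 + n) -> R}.
  by exists (fun y : 'rV[R]_(1 + n) => y 0 (lshift n 0)); do 2![eexists];
     do ?[constructor]; rewrite ?mxE// => ? *; rewrite ?mxE//; move=> ?; rewrite !mxE.
have cl : continuous l by exact: coord_continuous.
rewrite lE deriveE; last exact: (linear_differentiable (f := l)).
by rewrite (diff_lin (f := l) _ cl) mxE.
Qed.

Definition cyl_phi (J : N -> 'rV[R]_n -> 'rV[R]_n)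
    (p : cylinder) (u : 'rV[R]_(1 + n)) : 'rV[R]_(1 + n) :=
  row_mx 0 (J p.2 (rsubmx u)).

Definition warped_metric (f : R -> R) (g : N -> 'rV[R]_n -> 'rV[R]_n -> R)
    (p : cylinder) (u v : 'rV[R]_(1 + n)) : R :=
  cyl_eta p u * cyl_eta p v + f p.1 ^+ 2 * g p.2 (rsubmx u) (rsubmx v).

End Cylinder.

(* Main.v *)
Require Import Defs.
From mathcomp Require Import all_boot all_order all_algebra.
From mathcomp Require Import all_classical all_reals all_analysis.
From mathcomp Require Import ring lra.

Import Order.TTheory GRing.Theory Num.Theory.
Import numFieldNormedType.Exports.

Local Open Scope classical_set_scope.
Local Open Scope ring_scope.

Set Implicit Arguments.
Unset Strict Implicit.
Unset Printing Implicit Defensive.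

(** The Levi-Civita connection of the warped product can be written down.  Let
    X = a d/dt + X' and Y = b d/dt + Y' with X', Y' tangent to N, and let X'_t
    be the restriction of X' to the slice {t} x N, a vector field on N.  Then

      D_X Y = (X(b) - f f' g(X', Y')) d/dt
              + a dY'/dt + nabla_{X'_t} Y'_t + (f'/f) (a Y' + b X'),

    where dY'/dt is taken at a fixed point x of N, that is in the fixed vector
    space T_x N ([warped_conn]).  Four points carry the proof.

    - Smoothness of D_X Y ([smooth_warped_conn]).  In the frame e_i given by a
      chart c of N, the N-components of D_X Y are
      X(Y^k) + sum_ij X^i Y^j Gamma_ij^k + (f'/f) (a Y^k + b X^k)
      ([warped_conn_comp]), which is smooth because Gamma_ij = nabla_{e_i} e_j is
      smooth on the domain of c.  Since the fields of the frame exist only on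
      that domain, this uses that a connection is a local operator
      ([conn_eql], [conn_eqr], [conn_chart]).
    - D is a connection, torsion free and metric ([warped_connection],
      [warped_torsion_free], [warped_metric_connection]).  Along N this is
      inherited from nabla, slice by slice; along d/dt it is calculus, with
      the symmetry of mixed derivatives ([derive_swap], [cfield_comm],
      [time_vderiv]) in the case of the torsion.
    - Uniqueness ([levi_civita_unique]): the difference of two Levi-Civita
      connections is symmetric in its two arguments and skew with respect to
      the metric, hence zero.  So an arbitrary Levi-Civita connection of the
      warped product agrees with D on smooth fields.
    - The Kenmotsu identity for D ([warped_conn_phi]).  J commutes with d/dt at
      a fixed point of N and is parallel for nabla, so in
      (D_X phi) Y = D_X (phi Y) - phi (D_X Y) only two terms survive: the
      d/dt-component - f f' g(X', J Y') = - (f'/f) <X, phi Y> of the first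
      summand and - (f'/f) b J X' coming from the second. *)

(** * Functions of class C^k *)

Section CkCalculus.
Variable R : realType.
Implicit Types U V W : normedModType R.

Lemma CkW V W k (A : set V) (f : V -> W) : Ck k.+1 A f -> Ck k A f.
Proof.
elim: k f => [|k IH] f [df Cf]; first by move=> x Ax; exact/differentiable_continuous/df.
by split=> // v; exact: IH.
Qed.

Lemma Ck_sub V W k (A B : set V) (f : V -> W) : A `<=` B -> Ck k B f -> Ck k A f.
Proof.
move=> AB; elim: k f => [|k IH] f /= => [Cf x /AB|[df Cf]]; first exact: Cf.
by split=> [x /AB|v]; [exact: df|exact: IH].
Qed.

Lemma CkM V k (A : set V) (h g : V -> R) : open A ->
  Ck k A h -> Ck k A g -> Ck k A (fun x => h x * g x).
Proof.
move=> oA; elim: k h g => [|k IH] h g.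
  by move=> Ch Cg x Ax; apply: continuousM; [exact: Ch|exact: Cg].
move=> Ch Cg; have Ch' := CkW Ch; have Cg' := CkW Cg.
case: Ch Cg => dh Ch [dg Cg]; split=> [x Ax|v].
  by apply: differentiableM; [exact: dh|exact: dg].
apply: Ck_ext (CkD oA (IH _ _ Ch' (Cg v)) (IH _ _ Cg' (Ch v))) => // x Ax.
by rewrite -/(h * g) deriveM//; apply: diff_derivable; [exact: dh|exact: dg].
Qed.

Lemma Ck_scalel V W k (A : set V) (h : V -> R) (w : W) : open A ->
  Ck k A h -> Ck k A (fun x => h x *: w).
Proof.
move=> oA; elim: k h => [|k IH] h.
  by move=> Ch x Ax; apply: continuousZr_tmp; exact: Ch.
move=> [dh Ch]; split=> [x Ax|v]; first exact/differentiableZl/dh.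
apply: Ck_ext (IH _ (Ch v)) => // x Ax.
rewrite [RHS]deriveE; last exact/differentiableZl/dh.
by rewrite diffZl ?deriveE//; exact: dh.
Qed.

Lemma Ck_coord V m n k (A : set V) (F : V -> 'M[R]_(m, n)) i j : open A ->
  Ck k A F -> Ck k A (fun x => F x i j).
Proof.
move=> oA; elim: k F => [|k IH] F.
  move=> CF x Ax; apply: (@continuous_comp _ _ _ F (fun M : 'M[R]_(m, n) => M i j)).
    exact: CF.
  exact: coord_continuous.
move=> [dF CF]; split=> [x Ax|v].
  apply: (@differentiable_comp _ _ _ _ F (fun M : 'M[R]_(m, n) => M i j)); first exact: dF.
  exact: differentiable_coord.
apply: Ck_ext (IH _ (CF v)) => // x Ax.
by rewrite derive_mx ?mxE//; exact/diff_derivable/dF.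
Qed.

Lemma Ck_sum V W k (A : set V) (I : Type) (r : seq I) (F : I -> V -> W) : open A ->
  (forall i, Ck k A (F i)) -> Ck k A (fun x => \sum_(i <- r) F i x).
Proof.
move=> oA CF; elim: r => [|i r IH].
  by apply: Ck_ext (Ck_cst k 0 oA) => // x _; rewrite big_nil.
by apply: Ck_ext (CkD oA (CF i) IH) => // x _; rewrite big_cons.
Qed.

Lemma Ck_mx V m n k (A : set V) (F : V -> 'M[R]_(m, n)) : open A ->
  (forall i j, Ck k A (fun x => F x i j)) -> Ck k A F.
Proof.
move=> oA CF.
have CS : Ck k A (fun x => \sum_i \sum_j F x i j *: delta_mx i j).
  by apply: Ck_sum => // i; apply: Ck_sum => // j; exact: Ck_scalel.
by apply: Ck_ext CS => // x _; rewrite -matrix_sum_delta.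
Qed.

Lemma derive_lin V W (f : V -> W) x (a : R) u v : differentiable f x ->
  'D_(a *: u + v) f x = a *: 'D_u f x + 'D_v f x.
Proof. by move=> df; rewrite !deriveE// linearP. Qed.

Lemma derive_sumE V W m (f : V -> W) x (a : 'I_m -> R) (v : 'I_m -> V) :
  differentiable f x ->
  'D_(\sum_i a i *: v i) f x = \sum_i a i *: 'D_(v i) f x.
Proof.
move=> df; rewrite deriveE// linear_sum.
by apply: eq_bigr => i _; rewrite linearZ deriveE.
Qed.

Lemma derive_rowE W m (f : 'rV[R]_m -> W) x v : differentiable f x ->
  'D_v f x = \sum_j v 0 j *: 'D_(delta_mx 0 j) f x.
Proof. by move=> df; rewrite {1}(row_sum_delta v) derive_sumE. Qed.

Lemma derive_comp U V W (f : U -> V) (g : V -> W) x u :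
  differentiable f x -> differentiable g (f x) ->
  'D_u (g \o f) x = 'D_('D_u f x) g (f x).
Proof.
move=> df dg; rewrite deriveE; last exact: differentiable_comp.
by rewrite diff_comp// !deriveE.
Qed.

(** By the chain rule D_v (g o f) = sum_j (D_v f)_j (D_j g o f), a sum of
    products to which induction on k applies. *)
Lemma Ck_comp V m k (A : set V) (B : set 'rV[R]_m) (f : V -> 'rV[R]_m)
    (g : 'rV[R]_m -> R) : open A -> (forall x, A x -> B (f x)) ->
  Ck k A f -> Ck k B g -> Ck k A (g \o f).
Proof.
move=> oA fAB; elim: k f g fAB => [|k IH] f g fAB.
  move=> Cf Cg x Ax; apply: continuous_comp; first exact: Cf.
  exact/Cg/fAB.
move=> Cf Cg; have Cf' := CkW Cf.
case: Cf Cg => df Cf [dg Cg]; split=> [x Ax|v].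
  by apply: differentiable_comp; [exact: df|exact/dg/fAB].
have CS : Ck k A (fun x => \sum_j 'D_v f x 0 j * ('D_(delta_mx 0 j) g \o f) x).
  apply: Ck_sum => // j; apply: CkM => //; first exact/Ck_coord/Cf.
  by apply: IH => //; exact: Cg.
apply: Ck_ext CS => // x Ax.
rewrite [RHS]derive_comp; [|exact: df|exact/dg/fAB].
by rewrite [RHS]derive_rowE//; exact/dg/fAB.
Qed.

Lemma Ck_comp1 V k (A : set V) (l : V -> R) (f : R -> R) : open A ->
  Ck k A l -> Ck k setT f -> Ck k A (f \o l).
Proof.
move=> oA; elim: k f => [|k IH] f.
  by move=> Cl Cf x Ax; apply: continuous_comp; [exact: Cl|exact: Cf].
move=> Cl Cf; have Cl' := CkW Cl; case: Cl Cf => dl Cl [df Cf].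
split=> [x Ax|v].
  by apply: differentiable_comp; [exact: dl|exact: df].
have C1 : Ck k A (fun x => 'D_v l x * ('D_1 f \o l) x).
  exact: CkM oA (Cl v) (IH _ Cl' (Cf 1)).
apply: Ck_ext C1 => // x Ax; rewrite [RHS]derive_comp; [|exact: dl|exact: df].
have df' := df (l x) I.
have -> : 'D_v l x = 'D_v l x *: 1 :> R by rewrite [RHS]mulr1.
by rewrite [in RHS]deriveE// linearZ /= -(deriveE _ df') [_%:A]mulr1.
Qed.

Lemma CkV V k (A : set V) (h : V -> R) : open A ->
  (forall x, A x -> h x != 0) -> Ck k A h -> Ck k A (fun x => (h x)^-1).
Proof.
move=> oA h0; elim: k => [|k IH].
  by move=> Ch x Ax; apply: continuousV; [exact: h0|exact: Ch].
move=> Ch; have CV := IH (CkW Ch); case: Ch => dh Ch; split=> [x Ax|v].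
  by apply: differentiableV; [exact: dh|exact: h0].
have C1 := CkM oA (@Ck_cst R V R k A (- 1) oA) (CkM oA (CkM oA CV CV) (Ch v)).
apply: Ck_ext C1 => // x Ax; rewrite deriveV; last 2 first.
- exact: h0.
- exact/diff_derivable/dh.
by rewrite /cst mulN1r expr2 invfM -scaleNr.
Qed.

End CkCalculus.

(** * Symmetry of second derivatives *)

Section Schwarz.
Variables (R : realType) (m : nat).
Implicit Types (F : 'rV[R]_m -> R) (A : set 'rV[R]_m).

Lemma is_derive_line (V W : normedModType R) (F : V -> W) z u (r : R) :
  derivable F (z + r *: u) u ->
  is_derive r 1 (fun t : R => F (z + t *: u)) ('D_u F (z + r *: u)).
Proof.
have E : (fun h : R => h^-1 *: (((fun t : R => F (z + t *: u)) \o shift r) (h *: 1)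
    - F (z + r *: u)))
  = (fun h => h^-1 *: ((F \o shift (z + r *: u)) (h *: u) - F (z + r *: u))).
  apply/funext => h /=; congr (_ *: (F _ - _)).
  by rewrite [h%:A]mulr1 scalerDl addrCA.
by move=> dF; split; rewrite /derivable /derive E.
Qed.

Lemma MVT_line F z u (s : R) : 0 < s ->
  (forall r, 0 <= r <= s -> derivable F (z + r *: u) u) ->
  exists2 c, 0 < c < s & F (z + s *: u) - F z = s * 'D_u F (z + c *: u).
Proof.
move=> s0 dF; pose f (t : R) := F (z + t *: u).
have df r : r \in `[0, s] -> is_derive r 1 f ('D_u F (z + r *: u)).
  by rewrite in_itv /= => /dF; exact: is_derive_line.
have cf : {within `[0, s], continuous f}.
  by apply: derivable_within_continuous => r /df [].
have df' r : r \in `]0, s[ -> is_derive r 1 f ('D_u F (z + r *: u)).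
  by move=> rs; apply: df; apply: subset_itv_oo_cc.
have [c] := MVT s0 df' cf.
rewrite in_itv /= => cs; rewrite /f scale0r addr0 subr0 => E.
by exists c => //; rewrite mulrC.
Qed.

(** The mean value theorem twice: along u for x |-> F (x + s v) - F x, then along v
    for D_u F. *)
Lemma second_difference F A y u v (s : R) : 0 < s ->
  (forall x, A x -> differentiable F x) ->
  (forall x, A x -> differentiable ('D_u F) x) ->
  (forall r t, 0 <= r <= s -> 0 <= t <= s -> A (y + r *: u + t *: v)) ->
  exists c d, [/\ 0 <= c <= s, 0 <= d <= s &
    F (y + s *: u + s *: v) - F (y + s *: u) - F (y + s *: v) + F y
    = s * s * 'D_v ('D_u F) (y + c *: u + d *: v)].
Proof.
move=> s0 dF dDF Asq; have ss : 0 <= s <= s by rewrite (ltW s0) lexx.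
have zs : (0 : R) <= 0 <= s by rewrite lexx ltW.
pose G x := F (x + s *: v) - F x.
have dG r : 0 <= r <= s -> is_derive (y + r *: u) u G
    ('D_u F (y + r *: u + s *: v) - 'D_u F (y + r *: u)).
  move=> rs; have A0 := Asq _ _ rs zs; rewrite scale0r addr0 in A0.
  have d1 := derivableP (diff_derivable (v := u) (dF _ A0)).
  have E : (fun h : R => h^-1 *: (((fun x => F (x + s *: v)) \o shift (y + r *: u)) (h *: u)
      - F (y + r *: u + s *: v)))
    = (fun h => h^-1 *: ((F \o shift (y + r *: u + s *: v)) (h *: u) - F (y + r *: u + s *: v))).
    by apply/funext => h /=; rewrite -addrA.
  have d2 : is_derive (y + r *: u) u (fun x => F (x + s *: v)) ('D_u F (y + r *: u + s *: v)).
    have D := diff_derivable (v := u) (dF _ (Asq _ _ rs ss)).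
    by split; rewrite /derivable /derive E.
  exact: is_deriveB.
have [|c cs Ec] := @MVT_line G y u s s0; first by move=> r /dG [].
have cs' : 0 <= c <= s by case/andP: cs => /ltW -> /ltW ->.
have [|d ds Ed] := @MVT_line ('D_u F) (y + c *: u) v s s0.
  by move=> r rs; apply/diff_derivable/dDF/Asq.
exists c, d; split=> //; first by case/andP: ds => /ltW -> /ltW ->.
have [_ DG] := dG _ cs'; rewrite DG Ed in Ec.
by rewrite -mulrA -Ec /G addrAC [y + s *: u + _]addrAC; ring.
Qed.

(** The second difference of F is symmetric in u and v, so the two mixed
    derivatives take a common value, at two different points arbitrarily
    close to y; their continuity at y concludes. *)
Lemma derive_swap F A y u v : open A -> A y -> Ck 2 A F ->
  'D_v ('D_u F) y = 'D_u ('D_v F) y.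
Proof.
move=> oA Ay [dF CF]; have [dFu cFu] := CF u; have [dFv cFv] := CF v.
have cu := cFu v y Ay; have cv := cFv u y Ay.
apply/eqP; rewrite -subr_eq0 -normr_le0; apply/ler_addgt0Pr => e e0; rewrite add0r.
have e2 : 0 < e / 2 by rewrite divr_gt0.
have N : \forall x \near y, [/\ A x,
    `|'D_v ('D_u F) y - 'D_v ('D_u F) x| < e / 2 &
    `|'D_u ('D_v F) y - 'D_u ('D_v F) x| < e / 2].
  have N0 : \forall x \near y, A x by exact: open_nbhs_nbhs.
  have N1 : \forall x \near y, `|'D_v ('D_u F) y - 'D_v ('D_u F) x| < e / 2.
    by move/cvgrPdist_lt: cu; apply.
  have N2 : \forall x \near y, `|'D_u ('D_v F) y - 'D_u ('D_v F) x| < e / 2.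
    by move/cvgrPdist_lt: cv; apply.
  by apply: filterS3 N0 N1 N2 => x; split.
have [d /= d0 Nd] := (nbhs_ballP _ _).1 N.
(* a step for which the whole parallelogram spanned at y stays in the ball *)
pose s := d / (1 + `|u| + `|v|) / 2.
have K0 : 0 < 1 + `|u| + `|v| by rewrite -addrA ltr_pwDl// addr_ge0.
have s0 : 0 < s by rewrite !divr_gt0.
have sq r t : 0 <= r <= s -> 0 <= t <= s -> ball y d (y + r *: u + t *: v).
  move=> /andP[r0 rs] /andP[t0 ts].
  rewrite -ball_normE /= -addrA opprD addNKr normrN.
  apply: le_lt_trans (ler_normD _ _) _; rewrite !normrZ !ger0_norm//.
  have : r * `|u| + t * `|v| <= s * (1 + `|u| + `|v|).
    rewrite !mulrDr -addrA; apply: ler_wpDl; first by rewrite mulr_ge0 ?ler01 ?(ltW s0).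
    by apply: lerD; apply: ler_wpM2r.
  move/le_lt_trans; apply; rewrite /s mulrAC divfK ?gt_eqF//.
  by rewrite ltr_pdivrMr// ltr_pMr// ltr1n.
have sqA r t : 0 <= r <= s -> 0 <= t <= s -> A (y + r *: u + t *: v).
  by move=> hr ht; have [] := Nd _ (sq _ _ hr ht).
have [c [c' [hc hc' Ec]]] := second_difference s0 dF dFu sqA.
have [|b [b' [hb hb' Eb]]] := second_difference (u := v) (v := u) (y := y) (A := A) s0 dF dFv.
  by move=> r t hr ht; rewrite addrAC; exact: sqA.
have ss0 : s * s != 0 by rewrite mulf_neq0 ?gt_eqF.
have E : 'D_v ('D_u F) (y + c *: u + c' *: v) = 'D_u ('D_v F) (y + b' *: u + b *: v).
  rewrite (addrAC y (b' *: u)).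
  have Eq : s * s * 'D_v ('D_u F) (y + c *: u + c' *: v)
      = s * s * 'D_u ('D_v F) (y + b *: v + b' *: u).
    rewrite -[LHS]Ec.
    rewrite -[RHS]Eb.
    rewrite (addrAC y (s *: v)).
    by congr (_ + _); rewrite [LHS]addrAC.
  exact: (mulfI ss0 Eq).
have [_ N1 _] := Nd _ (sq _ _ hc hc'); have [_ _ N2] := Nd _ (sq _ _ hb' hb).
rewrite E in N1; rewrite distrC in N2.
apply: ltW; apply: le_lt_trans (ler_distD ('D_u ('D_v F) (y + b' *: u + b *: v)) _ _) _.
by have := ltrD N1 N2; rewrite -splitr.
Qed.

End Schwarz.

(** * Smooth functions *)

Section SmoothCalculus.
Variable R : realType.
Implicit Types U V W : normedModType R.

Lemma smooth_ext V W (A : set V) (f g : V -> W) : open A ->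
  (forall x, A x -> f x = g x) -> smooth A f -> smooth A g.
Proof. by move=> oA fg sf k; exact: Ck_ext fg (sf k). Qed.

Lemma smooth_sub V W (A B : set V) (f : V -> W) :
  A `<=` B -> smooth B f -> smooth A f.
Proof. by move=> AB sf k; exact: Ck_sub AB (sf k). Qed.

Lemma smoothD V W (A : set V) (f g : V -> W) : open A ->
  smooth A f -> smooth A g -> smooth A (fun x => f x + g x).
Proof. by move=> oA sf sg k; exact: CkD. Qed.

Lemma smoothM V (A : set V) (f g : V -> R) : open A ->
  smooth A f -> smooth A g -> smooth A (fun x => f x * g x).
Proof. by move=> oA sf sg k; exact: CkM. Qed.

Lemma smoothV V (A : set V) (h : V -> R) : open A ->
  (forall x, A x -> h x != 0) -> smooth A h -> smooth A (fun x => (h x)^-1).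
Proof. by move=> oA h0 sh k; exact: CkV. Qed.

Lemma smooth_cst V W (A : set V) (w : W) : open A -> smooth A (fun=> w).
Proof. by move=> oA k; exact: Ck_cst. Qed.

Lemma smooth_sum V W (A : set V) (I : Type) (r : seq I) (F : I -> V -> W) :
  open A -> (forall i, smooth A (F i)) -> smooth A (fun x => \sum_(i <- r) F i x).
Proof. by move=> oA sF k; apply: Ck_sum => // i; exact: sF. Qed.

Lemma smooth_coord V m n (A : set V) (F : V -> 'M[R]_(m, n)) i j : open A ->
  smooth A F -> smooth A (fun x => F x i j).
Proof. by move=> oA sF k; exact/Ck_coord/sF. Qed.

Lemma smooth_mx V m n (A : set V) (F : V -> 'M[R]_(m, n)) : open A ->
  (forall i j, smooth A (fun x => F x i j)) -> smooth A F.
Proof. by move=> oA sF k; apply: Ck_mx => // i j; exact: sF. Qed.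

Lemma smooth_lin V W (A : set V) (L : {linear V -> W}) : open A ->
  continuous L -> smooth A L.
Proof. by move=> oA cL k; exact: Ck_lin. Qed.

Lemma smooth_diff V W (A : set V) (f : V -> W) x :
  smooth A f -> A x -> differentiable f x.
Proof. by move=> /(_ 1%N) [df _]; exact: df. Qed.

Lemma smooth_derive V W (A : set V) (f : V -> W) v :
  smooth A f -> smooth A ('D_v f).
Proof. by move=> sf k; have [_] := sf k.+1; exact. Qed.

Lemma smooth_comp V m p q (A : set V) (B : set 'rV[R]_m) (f : V -> 'rV[R]_m)
    (g : 'rV[R]_m -> 'M[R]_(p, q)) : open A -> open B ->
  (forall x, A x -> B (f x)) -> smooth A f -> smooth B g -> smooth A (g \o f).
Proof.
move=> oA oB fAB sf sg; apply: smooth_mx => // i j k.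
by apply: (Ck_comp (g := fun y => g y i j)) fAB _ _ => //; exact: smooth_coord.
Qed.

Lemma smooth_compr V m (A : set V) (B : set 'rV[R]_m) (f : V -> 'rV[R]_m)
    (g : 'rV[R]_m -> R) : open A ->
  (forall x, A x -> B (f x)) -> smooth A f -> smooth B g -> smooth A (g \o f).
Proof. by move=> oA fAB sf sg k; apply: Ck_comp fAB _ _. Qed.

Lemma smooth_scale V m n (A : set V) (h : V -> R) (F : V -> 'M[R]_(m, n)) :
  open A -> smooth A h -> smooth A F -> smooth A (fun x => h x *: F x).
Proof.
move=> oA sh sF; apply: smooth_mx => // i j.
apply: (smooth_ext (f := fun x => h x * F x i j)) => // [x _|]; first by rewrite mxE.
by apply: smoothM => //; exact: smooth_coord.
Qed.

Lemma smooth_derive_dir m p q (A : set 'rV[R]_m) (w : 'rV[R]_m -> 'rV[R]_m)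
    (F : 'rV[R]_m -> 'M[R]_(p, q)) : open A -> smooth A w -> smooth A F ->
  smooth A (fun y => 'D_(w y) F y).
Proof.
move=> oA sw sF.
apply: (smooth_ext (f := fun y => \sum_j w y 0 j *: 'D_(delta_mx 0 j) F y)) => //.
  by move=> y Ay; rewrite [RHS]derive_rowE//; exact: smooth_diff Ay.
apply: smooth_sum => // j; apply: smooth_scale => //; first exact: smooth_coord.
exact: smooth_derive.
Qed.

Lemma smooth_derive_dirr m (A : set 'rV[R]_m) (w : 'rV[R]_m -> 'rV[R]_m)
    (F : 'rV[R]_m -> R) : open A -> smooth A w -> smooth A F ->
  smooth A (fun y => 'D_(w y) F y).
Proof.
move=> oA sw sF.
apply: (smooth_ext (f := fun y => \sum_j w y 0 j * 'D_(delta_mx 0 j) F y)) => //.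
  by move=> y Ay; rewrite [RHS]derive_rowE//; exact: smooth_diff Ay.
apply: smooth_sum => // j; apply: smoothM => //; first exact: smooth_coord.
exact: smooth_derive.
Qed.

End SmoothCalculus.

(** * Derivatives and vector fields in charts *)

Section Charts.
Variables (R : realType) (n : nat) (M : manifold R n).
Implicit Types (p : M) (c : chart R M n) (U : set M) (X Y : vfield M).

(** Differentiability at p, read in the preferred chart because [vderiv] is; by
    [vdiff_chart] any other chart of the atlas would do. *)
Definition vdiff (W : normedModType R) p (h : M -> W) :=
  differentiable (h \o c_inv (chart_at p)) (chart_at p p).

Lemma chart_change (W : normedModType R) c c' p (h : M -> W) :
  atlas M c -> atlas M c' -> c_dom c p -> c_dom c' p ->
  differentiable (h \o c_inv c) (c p) ->
  differentiable (h \o c_inv c') (c' p) /\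
  forall v, 'D_v (h \o c_inv c') (c' p)
    = 'D_('D_v (c \o c_inv c') (c' p)) (h \o c_inv c) (c p).
Proof.
move=> ac ac' cp cp' dh; pose A := c_set c' (c_dom c).
have oA : open A by exact/c_set_open/c_dom_open.
have Ap : A (c' p) by split; [exact: c_mapP|rewrite /preimage /= c_mapK].
have dt : differentiable (c \o c_inv c') (c' p) by exact: smooth_diff (atlas_smooth ac' ac) Ap.
have E : \forall y \near c' p,
    ((h \o c_inv c) \o (c \o c_inv c')) y = (h \o c_inv c') y.
  apply: filterS (open_nbhs_nbhs (conj oA Ap)) => y [_ Ay] /=.
  by rewrite c_mapK.
have cpE : (c \o c_inv c') (c' p) = c p by rewrite /= c_mapK.
split=> [|v].
  apply: near_eq_differentiable E _; apply: differentiable_comp => //.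
  by rewrite cpE.
by rewrite -(near_eq_derive v E) derive_comp ?cpE.
Qed.

Lemma vdiff_chart (W : normedModType R) c p (h : M -> W) :
  atlas M c -> c_dom c p -> differentiable (h \o c_inv c) (c p) -> vdiff p h.
Proof.
move=> ac cp dh; apply: (chart_change ac _ cp _ dh).1.
  exact: chart_at_atlas.
exact: chart_at_dom.
Qed.

Lemma vderiv_chart (W : normedModType R) c p v (h : M -> W) :
  atlas M c -> c_dom c p -> differentiable (h \o c_inv c) (c p) ->
  vderiv p v h = 'D_(vderiv p v c) (h \o c_inv c) (c p).
Proof.
move=> ac cp dh; apply: (chart_change ac _ cp _ dh).2.
  exact: chart_at_atlas.
exact: chart_at_dom.
Qed.

Lemma in_c_set c U p : c_dom c p -> U p -> c_set c U (c p).
Proof. by move=> cp Up; split; [exact: c_mapP|rewrite /preimage /= c_mapK]. Qed.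

Lemma smooth_fun_diff c U p h : smooth_fun U h -> atlas M c -> c_dom c p -> U p ->
  differentiable (h \o c_inv c) (c p).
Proof. by move=> sh ac cp Up; apply: smooth_diff (sh c ac) _; exact: in_c_set. Qed.

Lemma smooth_vdiff U p h : smooth_fun U h -> U p -> vdiff p h.
Proof.
by move=> sh Up; exact: (smooth_fun_diff sh (chart_at_atlas p) (chart_at_dom p) Up).
Qed.

Lemma vdiff_atlas c p : atlas M c -> c_dom c p -> vdiff p c.
Proof.
move=> ac cp; apply: smooth_diff (atlas_smooth (chart_at_atlas p) ac) _.
by apply: in_c_set => //; exact: chart_at_dom.
Qed.

Lemma vderivP (W : normedModType R) p a u v (h : M -> W) : vdiff p h ->
  vderiv p (a *: u + v) h = a *: vderiv p u h + vderiv p v h.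
Proof. exact: derive_lin. Qed.

Lemma vderivDl (W : normedModType R) p u v (h : M -> W) : vdiff p h ->
  vderiv p (u + v) h = vderiv p u h + vderiv p v h.
Proof. by move=> dh; have := vderivP 1 u v dh; rewrite !scale1r. Qed.

Lemma vderivZl (W : normedModType R) p a u (h : M -> W) : vdiff p h ->
  vderiv p (a *: u) h = a *: vderiv p u h.
Proof.
move=> dh; have := vderivP a u 0 dh; rewrite addr0 => ->.
by rewrite [X in _ + X]/vderiv derive0 addr0.
Qed.

Lemma vderiv_sumE (W : normedModType R) p m (a : 'I_m -> R) v (h : M -> W) :
  vdiff p h -> vderiv p (\sum_i a i *: v i) h = \sum_i a i *: vderiv p (v i) h.
Proof. exact: derive_sumE. Qed.

Lemma vderiv_near (W : normedModType R) U p v (h h' : M -> W) : open U -> U p ->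
  (forall q, U q -> h q = h' q) -> vderiv p v h = vderiv p v h'.
Proof.
move=> oU Up hh'; apply: near_eq_derive.
have oA : open (c_set (chart_at p) U) by exact: c_set_open.
apply: filterS (open_nbhs_nbhs (conj oA (in_c_set (chart_at_dom p) Up))).
by move=> y [_ Uy] /=; exact: hh'.
Qed.

Lemma vderivD p v (h h' : M -> R) : vdiff p h -> vdiff p h' ->
  vderiv p v (fun q => h q + h' q) = vderiv p v h + vderiv p v h'.
Proof. by move=> dh dh'; apply: deriveD; exact: diff_derivable. Qed.

Lemma vderivM p v (h h' : M -> R) : vdiff p h -> vdiff p h' ->
  vderiv p v (fun q => h q * h' q) = h p * vderiv p v h' + h' p * vderiv p v h.
Proof.
move=> dh dh'; rewrite /vderiv [LHS]deriveM; try exact: diff_derivable.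
by rewrite /= c_mapK//; exact: chart_at_dom.
Qed.

Lemma vdiffD p (h h' : M -> R) : vdiff p h -> vdiff p h' ->
  vdiff p (fun q => h q + h' q).
Proof. exact: differentiableD. Qed.

Lemma vdiffM p (h h' : M -> R) : vdiff p h -> vdiff p h' ->
  vdiff p (fun q => h q * h' q).
Proof. exact: differentiableM. Qed.

Lemma vderiv_id p v : vderiv p v (chart_at p) = v.
Proof.
rewrite -[RHS](derive_id (chart_at p p) v); apply: near_eq_derive.
have cp := c_mapP (chart_at_dom p).
apply: filterS (open_nbhs_nbhs (conj (c_img_open (chart_at p)) cp)) => y cy /=.
exact: c_invK.
Qed.

(** The field with constant components w in the chart c.  A tangent vector at p is
    stored by its components in the preferred chart of p, whence the
    derivative of the transition map. *)
Definition cfield c (w : 'rV[R]_n) : vfield M :=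
  fun p => 'D_w (chart_at p \o c_inv c) (c p).

Lemma diff_chart_at c p : atlas M c -> c_dom c p ->
  differentiable (chart_at p \o c_inv c) (c p).
Proof.
move=> ac cp; apply: smooth_diff (atlas_smooth ac (chart_at_atlas p)) _.
by apply: in_c_set => //; exact: chart_at_dom.
Qed.

Lemma cfieldK c p v : atlas M c -> c_dom c p -> cfield c (vderiv p v c) p = v.
Proof.
move=> ac cp; rewrite -[RHS](vderiv_id p) [RHS](vderiv_chart _ ac)//.
exact: diff_chart_at.
Qed.

Lemma vderiv_cfield c p w : atlas M c -> c_dom c p -> vderiv p (cfield c w p) c = w.
Proof.
move=> ac cp; have [_ E] :=
  chart_change (chart_at_atlas p) ac (chart_at_dom p) cp (vdiff_atlas ac cp).
rewrite /vderiv -E -[RHS](derive_id (c p) w); apply: near_eq_derive.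
apply: filterS (open_nbhs_nbhs (conj (c_img_open c) (c_mapP cp))) => y cy /=.
exact: c_invK.
Qed.

(** In another chart c' the components are D_w (c' o c^-1), a function on the
    image of c that has to be pulled back along the transition map. *)
Lemma smooth_cfield c w : atlas M c -> smooth_vfield (c_dom c) (cfield c w).
Proof.
move=> ac c' ac'; have oA : open (c_set c' (c_dom c)) by exact/c_set_open/c_dom_open.
have oB : open (c_set c (c_dom c')) by exact/c_set_open/c_dom_open.
apply: (@smooth_ext _ _ _ _ ('D_w (c' \o c_inv c) \o (c \o c_inv c')) _ oA).
  move=> y [c'y cy] /=; set p := c_inv c' y.
  have c'p : c_dom c' p by exact: c_invP.
  rewrite (vderiv_chart _ ac cy); first by rewrite vderiv_cfield.
  by apply: smooth_diff (atlas_smooth ac ac') _; exact: in_c_set.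
apply: (smooth_comp oA oB _ (atlas_smooth ac' ac)).
  by move=> y [c'y cy]; apply: in_c_set => //; exact: c_invP.
exact/smooth_derive/atlas_smooth.
Qed.

Lemma vfield_expand c p v : atlas M c -> c_dom c p ->
  v = \sum_i (vderiv p v c) 0 i *: cfield c (delta_mx 0 i) p.
Proof.
move=> ac cp; rewrite -[LHS](cfieldK v ac cp) /cfield derive_rowE//.
exact: diff_chart_at.
Qed.

(** Smoothness is required in every chart of the atlas; on the domain of c it
    is enough to check it in c, as transition maps are smooth. *)
Lemma smooth_fun_chart c U (h : M -> R) : open U -> atlas M c ->
  smooth (c_set c U) (h \o c_inv c) -> smooth_fun (U `&` c_dom c) h.
Proof.
move=> oU ac sh c' ac'.
have oA : open (c_set c' (U `&` c_dom c)).
  by apply: c_set_open; apply: openI => //; exact: c_dom_open.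
have st : smooth (c_set c' (U `&` c_dom c)) (c \o c_inv c').
  by apply: smooth_sub (atlas_smooth ac' ac) => y [c'y [_ cy]]; split.
apply: (smooth_ext (f := (h \o c_inv c) \o (c \o c_inv c'))) => //.
  by move=> y [c'y [Uy cy]] /=; rewrite c_mapK.
apply: (smooth_compr (B := c_set c U)) => // y [c'y [Uy cy]].
exact: in_c_set.
Qed.

Lemma smooth_vfield_coord c U X i : open U -> atlas M c -> smooth_vfield U X ->
  smooth_fun (U `&` c_dom c) (fun p => vderiv p (X p) c 0 i).
Proof.
move=> oU ac sX; apply: smooth_fun_chart => //.
exact/(smooth_coord (F := (fun p => vderiv p (X p) c) \o c_inv c))/sX/ac/c_set_open.
Qed.

Lemma smooth_chart_coord c i : atlas M c -> smooth_fun (c_dom c) (fun p => c p 0 i).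
Proof.
move=> ac c' ac'.
exact/(smooth_coord (F := c \o c_inv c'))/atlas_smooth/ac/ac'/c_set_open/c_dom_open.
Qed.

Lemma c_set_sub c U V : U `<=` V -> c_set c U `<=` c_set c V.
Proof. by move=> UV y [cy /UV]. Qed.

Lemma smooth_fun_sub U V h : U `<=` V -> smooth_fun V h -> smooth_fun U h.
Proof. by move=> UV sh c ac; apply: smooth_sub (sh c ac); exact: c_set_sub. Qed.

Lemma smooth_vfield_sub U V X : U `<=` V -> smooth_vfield V X -> smooth_vfield U X.
Proof. by move=> UV sX c ac; apply: smooth_sub (sX c ac); exact: c_set_sub. Qed.

Lemma smooth_fun_cst U (a : R) : open U -> smooth_fun U (fun=> a).
Proof. by move=> oU c ac; exact/smooth_cst/c_set_open. Qed.

Lemma smooth_funM U h h' : open U -> smooth_fun U h -> smooth_fun U h' ->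
  smooth_fun U (fun p => h p * h' p).
Proof.
by move=> oU sh sh' c ac; apply: smoothM;
  [exact: c_set_open|exact: sh|exact: sh'].
Qed.

Lemma smooth_vfieldZD U h X Y : open U -> smooth_fun U h -> smooth_vfield U X ->
  smooth_vfield U Y -> smooth_vfield U (fun p => h p *: X p + Y p).
Proof.
move=> oU sh sX sY c ac; have oA : open (c_set c U) by exact: c_set_open.
apply: smooth_ext (smoothD oA (smooth_scale oA (sh c ac) (sX c ac)) (sY c ac)) => //.
move=> y [cy Uy] /=; rewrite vderivP//; apply: vdiff_atlas => //.
exact: c_invP.
Qed.

Lemma smooth_vfield0 U : open U -> smooth_vfield U (fun=> 0).
Proof.
move=> oU c ac; apply: (smooth_ext (f := fun=> 0)); first exact: c_set_open.
  by move=> y _; rewrite /= /vderiv derive0.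
exact/smooth_cst/c_set_open.
Qed.

Lemma smooth_vfieldZ U h X : open U -> smooth_fun U h -> smooth_vfield U X ->
  smooth_vfield U (fun p => h p *: X p).
Proof.
move=> oU sh sX; have := smooth_vfieldZD oU sh sX (smooth_vfield0 oU).
by under [X in smooth_vfield _ X]funext do rewrite addr0.
Qed.

Lemma smooth_vfieldD U X Y : open U -> smooth_vfield U X -> smooth_vfield U Y ->
  smooth_vfield U (fun p => X p + Y p).
Proof.
move=> oU sX sY; have := smooth_vfieldZD oU (smooth_fun_cst 1 oU) sX sY.
by under [X in smooth_vfield _ X]funext do rewrite scale1r.
Qed.

Lemma smooth_vfieldB U X Y : open U -> smooth_vfield U X -> smooth_vfield U Y ->
  smooth_vfield U (fun p => X p - Y p).
Proof.
move=> oU sX sY; have := smooth_vfieldZD oU (smooth_fun_cst (-1) oU) sY sX.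
by under [X in smooth_vfield _ X]funext do rewrite scaleN1r addrC.
Qed.

Lemma smooth_vfield_sum U (I : Type) (r : seq I) (X : I -> vfield M) : open U ->
  (forall i, smooth_vfield U (X i)) ->
  smooth_vfield U (fun p => \sum_(i <- r) X i p).
Proof.
move=> oU sX; elim: r => [|i r IH].
  by under [X in smooth_vfield _ X]funext do rewrite big_nil; exact: smooth_vfield0.
under [X in smooth_vfield _ X]funext do rewrite big_cons.
exact: smooth_vfieldD oU (sX i) IH.
Qed.

Lemma smooth_vderiv U X h : open U -> smooth_vfield U X -> smooth_fun U h ->
  smooth_fun U (fun p => vderiv p (X p) h).
Proof.
move=> oU sX sh c ac; have oA : open (c_set c U) by exact: c_set_open.
apply: smooth_ext (smooth_derive_dirr oA (sX c ac) (sh c ac)) => // y [cy Uy].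
have cp : c_dom c (c_inv c y) by exact: c_invP.
by rewrite /= [RHS](vderiv_chart _ ac cp (smooth_fun_diff sh ac cp Uy)) c_invK.
Qed.

End Charts.

(** * Connections: locality and uniqueness of the Levi-Civita connection *)

Section Connections.
Variables (R : realType) (n : nat) (M : manifold R n).
Implicit Types (p : M) (U : set M) (X Y Z : vfield M).
Variable nabla : vfield M -> vfield M -> vfield M.
Hypothesis cnabla : connection nabla.

Lemma conn_smooth U X Y : open U -> smooth_vfield U X -> smooth_vfield U Y ->
  smooth_vfield U (nabla X Y).
Proof. by move=> oU sX sY; have [H _ _ _] := cnabla oU; exact: H sX sY. Qed.

Lemma connZDl U X X' Y h p : open U -> smooth_vfield U X -> smooth_vfield U X' ->
  smooth_vfield U Y -> smooth_fun U h -> U p ->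
  nabla (fun p => h p *: X p + X' p) Y p = h p *: nabla X Y p + nabla X' Y p.
Proof. by move=> oU sX sX' sY sh Up; have [_ H _ _] := cnabla oU; exact: H sX sX' sY sh _ Up. Qed.

Lemma connDr U X Y Y' p : open U -> smooth_vfield U X ->
  smooth_vfield U Y -> smooth_vfield U Y' -> U p ->
  nabla X (fun p => Y p + Y' p) p = nabla X Y p + nabla X Y' p.
Proof. by move=> oU sX sY sY' Up; have [_ _ H _] := cnabla oU; exact: H sX sY sY' _ Up. Qed.

Lemma connZr U X Y h p : open U -> smooth_vfield U X ->
  smooth_vfield U Y -> smooth_fun U h -> U p ->
  nabla X (fun p => h p *: Y p) p = vderiv p (X p) h *: Y p + h p *: nabla X Y p.
Proof. by move=> oU sX sY sh Up; have [_ _ _ H] := cnabla oU; exact: H sX sY sh _ Up. Qed.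

Lemma smooth_vfield_eq U X Y : open U -> (forall q, U q -> X q = Y q) ->
  smooth_vfield U X -> smooth_vfield U Y.
Proof.
move=> oU XY sX c ac; apply: smooth_ext (sX c ac); first exact: c_set_open.
by move=> y [_ Uy] /=; rewrite XY.
Qed.

Lemma conn0l U Y p : open U -> smooth_vfield U Y -> U p ->
  nabla (fun=> 0) Y p = 0.
Proof.
move=> oU sY Up; have s0 := smooth_vfield0 (M := M) oU.
have := connZDl oU s0 s0 sY (smooth_fun_cst 1 oU) Up.
under [X in nabla X]funext do rewrite scaler0 addr0.
rewrite scale1r => /eqP; rewrite -subr_eq0 opprD addNKr oppr_eq0.
by move/eqP.
Qed.

(** A field Z vanishing on U satisfies Z = off U Z everywhere, and off U is smooth
    on U, where it is 0: it replaces the bump function in the usual proof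
    that connections are local. *)
Let off U (q : M) : R := if `[< U q >] then 0 else 1.

Let offE U q : U q -> off U q = 0.
Proof. by move=> Uq; rewrite /off asboolT. Qed.

Let smooth_off U : open U -> smooth_fun U (off U).
Proof.
move=> oU c ac; apply: (smooth_ext (f := fun=> 0)); first exact: c_set_open.
  by move=> y [_ Uy]; rewrite /= offE.
exact/smooth_cst/c_set_open.
Qed.

(** The difference Z of the two fields vanishes on U, so nabla_Z Y is
    off U(p) nabla_Z Y = 0 at p. *)
Lemma conn_eql U X X' Y p : open U -> (forall q, U q -> X q = X' q) ->
  smooth_vfield U X -> smooth_vfield U Y -> U p -> nabla X Y p = nabla X' Y p.
Proof.
move=> oU XX' sX sY Up; have sX' := smooth_vfield_eq oU XX' sX.
pose Z q := X q - X' q.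
have Z0 q : U q -> Z q = 0 by move=> /XX' e; rewrite /Z e subrr.
have sZ : smooth_vfield U Z by exact: smooth_vfieldB.
have ZE : Z = (fun q => off U q *: Z q + 0).
  apply/funext => q; rewrite addr0 /off; case: asboolP => [/Z0 ->|_].
    by rewrite scaler0.
  by rewrite scale1r.
have NZ : nabla Z Y p = 0.
  rewrite ZE (connZDl oU sZ (smooth_vfield0 oU) sY (smooth_off oU) Up).
  by rewrite offE// scale0r add0r (conn0l oU).
have XE : X = (fun q => 1 *: Z q + X' q).
  by apply/funext => q; rewrite scale1r subrK.
rewrite XE (connZDl oU sZ sX' sY (smooth_fun_cst 1 oU) Up) NZ.
by rewrite scaler0 add0r.
Qed.

(** Here the Leibniz rule for Z = off U Z gives two terms, with factors Z(p) and
    off U(p), both zero. *)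
Lemma conn_eqr U X Y Y' p : open U -> (forall q, U q -> Y q = Y' q) ->
  smooth_vfield U X -> smooth_vfield U Y -> U p -> nabla X Y p = nabla X Y' p.
Proof.
move=> oU YY' sX sY Up; have sY' := smooth_vfield_eq oU YY' sY.
pose Z q := Y q - Y' q.
have Z0 q : U q -> Z q = 0 by move=> /YY' e; rewrite /Z e subrr.
have sZ : smooth_vfield U Z by exact: smooth_vfieldB.
have ZE : Z = (fun q => off U q *: Z q).
  apply/funext => q; rewrite /off; case: asboolP => [/Z0 ->|_].
    by rewrite scaler0.
  by rewrite scale1r.
have NZ : nabla X Z p = 0.
  rewrite ZE (connZr oU sX sZ (smooth_off oU) Up).
  by rewrite offE// Z0// scale0r addr0 scaler0.
have YE : Y = (fun q => Z q + Y' q) by apply/funext => q; rewrite subrK.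
by rewrite YE (connDr oU sX sZ sY' Up) NZ add0r.
Qed.

Lemma conn_suml U (I : Type) (r : seq I) (h : I -> M -> R) (X : I -> vfield M) Y p :
  open U -> (forall i, smooth_fun U (h i)) -> (forall i, smooth_vfield U (X i)) ->
  smooth_vfield U Y -> U p ->
  nabla (fun q => \sum_(i <- r) h i q *: X i q) Y p
    = \sum_(i <- r) h i p *: nabla (X i) Y p.
Proof.
move=> oU sh sX sY Up; elim: r => [|i r IH].
  rewrite big_nil; under [X in nabla X]funext do rewrite big_nil.
  exact: conn0l sY Up.
rewrite big_cons; under [X in nabla X]funext do rewrite big_cons.
have sS : smooth_vfield U (fun q => \sum_(j <- r) h j q *: X j q).
  by apply: (smooth_vfield_sum _ oU) => j; exact: smooth_vfieldZ oU (sh j) (sX j).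
by rewrite (connZDl oU (sX i) sS sY (sh i) Up) IH.
Qed.

Lemma conn_sumr U (I : Type) (r : seq I) (h : I -> M -> R) X (Y : I -> vfield M) p :
  open U -> (forall i, smooth_fun U (h i)) -> smooth_vfield U X ->
  (forall i, smooth_vfield U (Y i)) -> U p ->
  nabla X (fun q => \sum_(i <- r) h i q *: Y i q) p
    = \sum_(i <- r) (vderiv p (X p) (h i) *: Y i p + h i p *: nabla X (Y i) p).
Proof.
move=> oU sh sX sY Up; elim: r => [|i r IH].
  rewrite big_nil; under [X in nabla _ X]funext do rewrite big_nil.
  have s0 := smooth_vfield0 (M := M) oU.
  have := connZr oU sX s0 (smooth_fun_cst 0 oU) Up.
  by under [X in nabla _ X]funext do rewrite scaler0; rewrite scaler0 scale0r addr0.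
rewrite big_cons; under [X in nabla _ X]funext do rewrite big_cons.
have sS : smooth_vfield U (fun q => \sum_(j <- r) h j q *: Y j q).
  by apply: (smooth_vfield_sum _ oU) => j; exact: smooth_vfieldZ oU (sh j) (sY j).
rewrite (connDr oU sX (smooth_vfieldZ oU (sh i) (sY i)) sS Up) IH.
by rewrite (connZr oU sX (sY i) (sh i) Up).
Qed.

End Connections.

(** The difference S of the two connections satisfies S(A, B) = S(B, A) (no
    torsion) and g(S(A, B), C) = - g(S(A, C), B) (metric).  A trilinear form
    symmetric in its first two and skew in its last two arguments is zero.
    Taking for C the coordinate field with value S(X, Y) at p gives
    g(S(X, Y), S(X, Y)) = 0. *)
Lemma levi_civita_unique (R : realType) (n : nat) (M : manifold R n)
    (g : M -> 'rV[R]_n -> 'rV[R]_n -> R) (nabla nabla' : vfield M -> vfield M -> vfield M)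
    (U : set M) (X Y : vfield M) (p : M) :
  riemannian_metric g -> levi_civita g nabla -> levi_civita g nabla' ->
  open U -> smooth_vfield U X -> smooth_vfield U Y -> U p ->
  nabla X Y p = nabla' X Y p.
Proof.
move=> [glin gsym gpos _] [cn tn mn] [cn' tn' mn'] oU sX sY Up.
have gB u v w : g p u (v - w) = g p u v - g p u w.
  by rewrite -scaleN1r addrC glin mulN1r addrC.
pose c := chart_at p; pose V := U `&` c_dom c.
have oV : open V by apply: openI => //; exact: c_dom_open.
have Vp : V p by split=> //; exact: chart_at_dom.
have VU : V `<=` U by move=> ? [].
pose S A B := nabla A B p - nabla' A B p.
have Ssym A B : smooth_vfield V A -> smooth_vfield V B -> S A B = S B A.
  move=> sA sB; suff E : nabla A B p - nabla B A p = nabla' A B p - nabla' B A p.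
    rewrite /S -[nabla A B p](subrK (nabla B A p)) E.
    by rewrite addrAC [nabla' A B p - _]addrC addrK addrC.
  (* a tangent vector is determined by its action on the coordinate functions *)
  apply/rowP => i.
  have sc : smooth_fun V (fun q => c q 0 i).
    by apply: smooth_fun_sub (smooth_chart_coord i (chart_at_atlas p)) => ? [].
  have := tn _ _ _ _ oV sA sB sc _ Vp; rewrite -(tn' _ _ _ _ oV sA sB sc _ Vp).
  have vi w : vderiv p w (fun q => c q 0 i) = w 0 i.
    rewrite -[in RHS](vderiv_id p w) /vderiv [in RHS]derive_mx ?mxE//.
    by apply: diff_derivable; exact: (vdiff_atlas (chart_at_atlas p) (chart_at_dom p)).
  by rewrite !vi.
have Sskew A B C : smooth_vfield V A -> smooth_vfield V B -> smooth_vfield V C ->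
    g p (S A B) (C p) = - g p (S A C) (B p).
  move=> sA sB sC; have := mn _ _ _ _ oV sA sB sC _ Vp.
  rewrite (mn' _ _ _ _ oV sA sB sC _ Vp) /S.
  rewrite ![g p (_ - _) _]gsym !gB ![g p (C p) _]gsym; lra.
have S0 A B C : smooth_vfield V A -> smooth_vfield V B -> smooth_vfield V C ->
    g p (S A B) (C p) = 0.
  move=> sA sB sC.
  have E1 := Sskew _ _ _ sA sB sC; have E2 := Sskew _ _ _ sB sA sC.
  have E3 := Sskew _ _ _ sC sA sB.
  rewrite (Ssym _ _ sB sA) in E2; rewrite (Ssym _ _ sC sA) in E3.
  by rewrite (Ssym _ _ sB sC) (Ssym _ _ sC sB) in E2 E3; lra.
have [sX' sY'] := (smooth_vfield_sub VU sX, smooth_vfield_sub VU sY).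
apply/eqP; rewrite -subr_eq0; apply/negPn/negP => /(gpos p).
have ac := chart_at_atlas p; have cp := chart_at_dom p.
have sZ : smooth_vfield V (cfield c (vderiv p (S X Y) c)).
  by apply: smooth_vfield_sub (smooth_cfield _ ac) => ? [].
have := S0 _ _ _ sX' sY' sZ; rewrite cfieldK// /S => ->.
by rewrite ltxx.
Qed.

(** * Coordinate expressions *)

Section ChartComputations.
Variables (R : realType) (n : nat) (M : manifold R n).
Implicit Types (p : M) (U : set M) (X Y Z : vfield M) (c : chart R M n).

Lemma vderiv_coord p v (m : nat) (H : M -> 'rV[R]_m) i : vdiff p H ->
  vderiv p v H 0 i = vderiv p v (fun q => H q 0 i).
Proof. by move=> dH; rewrite /vderiv derive_mx ?mxE//; exact: diff_derivable. Qed.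

Lemma smooth_chart_vdiff (W : normedModType R) c U p (h : M -> W) : atlas M c ->
  smooth (c_set c U) (h \o c_inv c) -> c_dom c p -> U p -> vdiff p h.
Proof.
move=> ac sh cp Up; apply: (vdiff_chart ac cp); apply: smooth_diff sh _.
exact: in_c_set.
Qed.

(** The classical expression nabla_X Y = X(Y^k) e_k + X^i Y^j nabla_{e_i} e_j.  The
    expansions of X and Y in the frame hold on the domain of c only, hence
    the use of locality in both arguments. *)
Lemma conn_chart (nabla : vfield M -> vfield M -> vfield M) c U X Y p :
  connection nabla -> atlas M c -> open U -> smooth_vfield U X ->
  smooth_vfield U Y -> U p -> c_dom c p ->
  vderiv p (nabla X Y p) c = vderiv p (X p) (fun q => vderiv q (Y q) c)
    + \sum_i \sum_j (vderiv p (X p) c 0 i * vderiv p (Y p) c 0 j) *: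
        vderiv p (nabla (cfield c (delta_mx 0 i)) (cfield c (delta_mx 0 j)) p) c.
Proof.
move=> cn ac oU sX sY Up cp; pose V := U `&` c_dom c.
have oV : open V by exact: openI oU (c_dom_open c).
have Vp : V p by [].
have VU : V `<=` U by move=> ? [].
have sX' := smooth_vfield_sub VU sX; have sY' := smooth_vfield_sub VU sY.
pose e i : vfield M := cfield c (delta_mx 0 i).
have se i : smooth_vfield V (e i).
  by apply: smooth_vfield_sub (smooth_cfield _ ac) => ? [].
have sXi i := smooth_vfield_coord i oU ac sX.
have sYi i := smooth_vfield_coord i oU ac sY.
have dc := vdiff_atlas ac cp.
have XE q : V q -> X q = \sum_i vderiv q (X q) c 0 i *: e i q.
  by move=> [_ cq]; exact: vfield_expand.
have YE q : V q -> Y q = \sum_i vderiv q (Y q) c 0 i *: e i q.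
  by move=> [_ cq]; exact: vfield_expand.
rewrite (conn_eqr cn oV YE sX' sY' Vp) (conn_sumr cn _ oV sYi sX' se Vp).
under eq_bigr => j _.
  rewrite (conn_eql cn oV XE sX' (se j) Vp) (conn_suml cn _ oV sXi se (se j) Vp).
  over.
rewrite big_split /= (vderivDl _ _ dc).
rewrite (vderiv_sumE _ _ dc) (vderiv_sumE _ _ dc); congr (_ + _).
  have dY : vdiff p (fun q => vderiv q (Y q) c).
    exact: (smooth_chart_vdiff ac (sY c ac)).
  rewrite [RHS]row_sum_delta; apply: eq_bigr => j _.
  by rewrite vderiv_cfield// vderiv_coord.
rewrite exchange_big /=; apply: eq_bigr => j _.
rewrite (vderiv_sumE _ _ dc) scaler_sumr; apply: eq_bigr => i _.
by rewrite scalerA mulrC.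
Qed.

(** Both sides are second partial derivatives in the chart c. *)
Lemma cfield_comm c U (u v : 'rV[R]_n) h p : atlas M c -> open U -> smooth_fun U h ->
  U p -> c_dom c p ->
  vderiv p (cfield c u p) (fun q => vderiv q (cfield c v q) h)
  = vderiv p (cfield c v p) (fun q => vderiv q (cfield c u q) h).
Proof.
move=> ac oU sh Up cp; pose V := U `&` c_dom c.
have oV : open V by exact: openI oU (c_dom_open c).
have Vp : V p by [].
have sc w : smooth_vfield V (cfield c w).
  by apply: smooth_vfield_sub (smooth_cfield _ ac) => ? [].
have shV : smooth_fun V h by apply: smooth_fun_sub sh => ? [].
have oA : open (c_set c V) by exact: c_set_open.
have Ap : c_set c V (c p) by exact: in_c_set.
have E w w' : vderiv p (cfield c w p) (fun q => vderiv q (cfield c w' q) h)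
    = 'D_w ('D_w' (h \o c_inv c)) (c p).
  rewrite (vderiv_chart _ ac cp); last first.
    exact: smooth_fun_diff (smooth_vderiv oV (sc w') shV) ac cp Vp.
  rewrite (vderiv_cfield _ ac cp); apply: near_eq_derive.
  apply: filterS (open_nbhs_nbhs (conj oA Ap)) => y [cy [Uy cy']] /=.
  rewrite (vderiv_chart _ ac cy'); first by rewrite (vderiv_cfield _ ac cy') c_invK.
  exact: smooth_fun_diff sh ac cy' Uy.
by rewrite !E; apply: derive_swap oA Ap _; exact: shV.
Qed.

End ChartComputations.

(** * Differentiating through linear maps *)

Section LinearMaps.
Variable R : realType.

Lemma derive_linl (U V W : normedModType R) (L : {linear V -> W}) (F : U -> V) x u :
  continuous L -> differentiable F x -> 'D_u (L \o F) x = L ('D_u F x).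
Proof.
move=> cL dF; have dL y : differentiable L y by exact: linear_differentiable.
by rewrite derive_comp// [LHS]deriveE// (diff_lin _ cL).
Qed.

Lemma derive_linr (U V W : normedModType R) (L : {linear U -> V}) (F : V -> W) x u :
  continuous L -> differentiable F (L x) -> 'D_u (F \o L) x = 'D_(L u) F (L x).
Proof.
move=> cL dF; have dL y : differentiable L y by exact: linear_differentiable.
by rewrite derive_comp// (deriveE _ (dL x)) (diff_lin _ cL).
Qed.

Lemma derive_dir (U V W : normedModType R) (F : V -> W) z (G : U -> V) x u :
  differentiable F z -> differentiable G x ->
  'D_u (fun y => 'D_(G y) F z) x = 'D_('D_u G x) F z.
Proof.
move=> dF dG; rewrite [RHS]deriveE// -derive_linl//; last exact: diff_continuous.
by congr ('D_u _ x); apply/funext => y; rewrite /= deriveE.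
Qed.

Lemma linear_mulmx m k (L : 'rV[R]_m -> 'rV[R]_k) : linear L ->
  exists B : 'M[R]_(m, k), L = mulmxr B.
Proof.
move=> lL; have L0 : L 0 = 0.
  by have := lL (-1) 0 0; rewrite scaleN1r oppr0 addr0 scaleN1r addNr.
exists (\matrix_i L (delta_mx 0 i)); apply/funext => w /=.
rewrite {1}(row_sum_delta w) mulmx_sum_row.
under [RHS]eq_bigr do rewrite rowK.
elim/big_rec2: _ => [//|i y1 y2 _ <-]; exact: lL.
Qed.

End LinearMaps.

(** * Calculus on the cylinder *)

Section CylinderCalculus.
Variables (R : realType) (n : nat) (N : manifold R n).
Let M := cylinder N.
Implicit Types (p q : M) (u v : 'rV[R]_(1 + n)) (U : set M) (X Y Z : vfield M).
Implicit Types (c : chart R N n).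

Lemma cyl_atlasP c : atlas N c -> atlas M (cyl_chart c).
Proof. exact: imageP. Qed.

Lemma vderiv_horizontal (W : normedModType R) (h : M -> W) p (w : 'rV[R]_n) :
  vderiv p (row_mx 0 w) h = vderiv p.2 w (fun x => h (p.1, x)).
Proof.
case: p => t x /=; rewrite /vderiv /derive.
have E (s : R) : cyl_inv (chart_at x) (s *: row_mx 0 w + cyl_map (chart_at x) (t, x))
    = (t, c_inv (chart_at x) (s *: w + chart_at x x)).
  rewrite /cyl_inv /cyl_map scale_row_mx add_row_mx row_mxKl row_mxKr.
  by rewrite scaler0 add0r /= !mxE mulr1n.
have E0 : cyl_inv (chart_at x) (cyl_map (chart_at x) (t, x))
    = (t, c_inv (chart_at x) (chart_at x x)).
  by rewrite /cyl_inv /cyl_map row_mxKl row_mxKr /= !mxE ?mulr1n.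
suff -> : (fun s : R => s^-1 *: (((h \o c_inv (chart_at ((t, x) : M)))
    \o shift (cyl_map (chart_at x) (t, x))) (s *: row_mx 0 w) -
    (h \o cyl_inv (chart_at x)) (cyl_map (chart_at x) (t, x))))
  = (fun s => s^-1 *: ((((fun x' => h (t, x')) \o c_inv (chart_at x)) \o
      shift (chart_at x x)) (s *: w) - h (t, c_inv (chart_at x) (chart_at x x)))).
  by [].
by apply: funext => s; rewrite /shift /= E E0.
Qed.

Lemma cyl_split p u :
  u = cyl_eta p u *: cyl_xi p + row_mx 0 (rsubmx u).
Proof.
rewrite /cyl_xi scale_row_mx scaler0 add_row_mx addr0 add0r -{1}[u]hsubmxK.
by rewrite [lsubmx u in LHS]mx11_scalar scalemx1.
Qed.

(** Every derivation splits into a time derivative at a fixed point of N and a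
    derivation of N at a fixed time. *)
Lemma cyl_vderivE (W : normedModType R) (h : M -> W) p u : vdiff p h ->
  vderiv p u h = cyl_eta p u *: derive1 (fun s : R => h (s, p.2)) p.1
    + vderiv p.2 (rsubmx u) (fun x => h (p.1, x)).
Proof.
move=> dh; rewrite [in LHS](cyl_split p u) vderivP//.
by rewrite vderiv_xi vderiv_horizontal.
Qed.

Lemma derivable_time (W : normedModType R) (h : M -> W) p : vdiff p h ->
  derivable (fun s : R => h (s, p.2)) p.1 1.
Proof.
case: p => t x dh; have := diff_derivable (v := cyl_xi ((t, x) : M)) dh.
have E s : cyl_inv (chart_at x) (s *: cyl_xi ((t, x) : M) + cyl_map (chart_at x) (t, x))
    = (s + t, x).
  rewrite /cyl_inv /cyl_xi /cyl_map scale_row_mx add_row_mx row_mxKl row_mxKr.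
  have cx := chart_at_dom x.
  by rewrite scaler0 add0r /= c_mapK// !mxE !mulr1n mulr1.
have E0 : cyl_inv (chart_at x) (cyl_map (chart_at x) (t, x)) = (t, x).
  by rewrite cyl_mapK//; exact: chart_at_dom.
rewrite /derivable.
have -> : (fun s : R => s^-1 *: (((h \o c_inv (chart_at ((t, x) : M)))
    \o shift (cyl_map (chart_at x) (t, x))) (s *: cyl_xi ((t, x) : M)) -
    (h \o cyl_inv (chart_at x)) (cyl_map (chart_at x) (t, x))))
  = (fun s => s^-1 *: (((fun s => h (s, x)) \o shift t) (s *: 1) - h (t, x))).
  by apply: funext => s; rewrite /shift /= E E0 [s%:A]mulr1.
by [].
Qed.

(** Unlike [rsubmx (X p)], whose meaning depends on the preferred chart of p.2,
    this is a smooth function of p when X is smooth. *)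
Definition cyl_comp c X p : 'rV[R]_n := vderiv p.2 (rsubmx (X p)) c.

Lemma cyl_vderiv_chart c p u : atlas N c -> c_dom c p.2 ->
  vderiv p u (cyl_chart c) = row_mx (lsubmx u) (vderiv p.2 (rsubmx u) c).
Proof.
move=> ac cp.
have dc : vdiff p (cyl_chart c).
  by apply: (vdiff_atlas (M := M) (cyl_atlasP ac)).
rewrite -[LHS]hsubmxK; congr row_mx.
  rewrite /vderiv -(derive_linl (L := @lsubmx R 1 1 n) _ (@continuous_lsubmx R 1 1 n) dc).
  have -> : @lsubmx R 1 1 n \o (cyl_chart c \o c_inv (chart_at p)) = @lsubmx R 1 1 n.
    apply/funext => y; rewrite /= /cyl_map row_mxKl /cyl_inv /=.
    by rewrite -mx11_scalar.
  have dl : differentiable (@lsubmx R 1 1 n) (chart_at p p).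
    exact/linear_differentiable/continuous_lsubmx.
  by rewrite deriveE// (diff_lin _ (@continuous_lsubmx R 1 1 n)).
rewrite /vderiv -(derive_linl (L := @rsubmx R 1 1 n) _ (@continuous_rsubmx R 1 1 n) dc).
have -> : @rsubmx R 1 1 n \o (cyl_chart c \o c_inv (chart_at p))
    = (c \o c_inv (chart_at p.2)) \o @rsubmx R 1 1 n.
  by apply/funext => y; rewrite /= /cyl_map row_mxKr.
have E : @rsubmx R 1 1 n (chart_at p p) = chart_at p.2 p.2.
  by rewrite /= /cyl_map row_mxKr.
have dN : differentiable (c \o c_inv (chart_at p.2)) (@rsubmx R 1 1 n (chart_at p p)).
  by rewrite E; exact: vdiff_atlas.
transitivity ('D_(rsubmx u) (c \o c_inv (chart_at p.2)) (@rsubmx R 1 1 n (chart_at p p))).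
  exact: (derive_linr (L := @rsubmx R 1 1 n) _ (@continuous_rsubmx R 1 1 n) dN).
by rewrite E.
Qed.

Lemma smooth_row_mx m (A : set 'rV[R]_m) (F : 'rV[R]_m -> R) (G : 'rV[R]_m -> 'rV[R]_n) :
  open A -> smooth A F -> smooth A G -> smooth A (fun y => row_mx (F y)%:M (G y)).
Proof.
move=> oA sF sG; apply: smooth_mx => // i j; case: (split_ordP j) => k ->.
  apply: (smooth_ext oA _ sF) => y _.
  by rewrite row_mxEl !ord1 mxE mulr1n.
apply: (smooth_ext oA _ (smooth_coord i k oA sG)) => y _.
by rewrite row_mxEr.
Qed.

Lemma cyl_setE c U (y : 'rV[R]_(1 + n)) : c_set (cyl_chart c) U y ->
  c_dom c (cyl_inv c y).2 /\ U (cyl_inv c y).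
Proof. by move=> [cy Uy]; split=> //; exact: c_invP. Qed.

Lemma smooth_eta U X : open U -> smooth_vfield U X ->
  smooth_fun U (fun p => cyl_eta p (X p)).
Proof.
move=> oU sX _ [c ac <-].
have oA : open (c_set (cyl_chart c) U) by exact: c_set_open.
have sXc := smooth_coord 0 (lshift n 0) oA (sX _ (cyl_atlasP ac)).
apply: (smooth_ext oA _ sXc) => y /cyl_setE [cy Uy].
by rewrite /= (cyl_vderiv_chart _ ac cy) row_mxEl.
Qed.

Lemma smooth_cyl_comp c U X : open U -> atlas N c -> smooth_vfield U X ->
  smooth (c_set (cyl_chart c) U) (cyl_comp c X \o cyl_inv c).
Proof.
move=> oU ac sX; have oA : open (c_set (cyl_chart c) U) by exact: c_set_open.
apply: smooth_mx => // i j.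
have sXc := smooth_coord i (rshift 1 j) oA (sX _ (cyl_atlasP ac)).
apply: (smooth_ext oA _ sXc) => y /cyl_setE [cy Uy].
by rewrite /= (cyl_vderiv_chart _ ac cy) row_mxEr.
Qed.

(** The charts of the cylinder are products, so smoothness can be tested
    separately on the dt-component and on the N-components. *)
Lemma cyl_smoothP U X : open U ->
  smooth_fun U (fun p => cyl_eta p (X p)) ->
  (forall c, atlas N c -> smooth (c_set (cyl_chart c) U) (cyl_comp c X \o cyl_inv c)) ->
  smooth_vfield U X.
Proof.
move=> oU sl sr _ [c ac <-].
have oA : open (c_set (cyl_chart c) U) by exact: c_set_open.
apply: (smooth_ext oA _ (smooth_row_mx oA (sl _ (cyl_atlasP ac)) (sr c ac))).
move=> y /cyl_setE [cy Uy].
by rewrite [RHS]/= (cyl_vderiv_chart _ ac cy) /= -mx11_scalar.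
Qed.

Lemma smooth_pull c U (h : N -> R) : open U -> atlas N c -> smooth_fun (c_dom c) h ->
  smooth (c_set (cyl_chart c) U) ((fun p : M => h p.2) \o cyl_inv c).
Proof.
move=> oU ac sh; have oA : open (c_set (cyl_chart c) U) by exact: c_set_open.
apply: (smooth_compr (B := c_set c (c_dom c)) (f := @rsubmx R 1 1 n)
  (g := h \o c_inv c) oA).
- by move=> y [cy _]; split=> //; exact: c_invP.
- exact/smooth_lin/continuous_rsubmx.
- exact: sh.
Qed.

Lemma smooth_pullv c U (h : N -> 'rV[R]_n) : open U -> atlas N c ->
  smooth (c_set c (c_dom c)) (h \o c_inv c) ->
  smooth (c_set (cyl_chart c) U) ((fun p : M => h p.2) \o cyl_inv c).
Proof.
move=> oU ac sh; have oA : open (c_set (cyl_chart c) U) by exact: c_set_open.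
have oB : open (c_set c (c_dom c)) by apply: c_set_open; exact: c_dom_open.
apply: (smooth_comp (f := @rsubmx R 1 1 n) (g := h \o c_inv c) oA oB) => //.
- by move=> y [cy _]; split=> //; exact: c_invP.
- exact/smooth_lin/continuous_rsubmx.
Qed.

Lemma smooth_time U (f : R -> R) : open U -> smooth setT f ->
  smooth_fun U (fun p : M => f p.1).
Proof.
move=> oU sf _ [c ac <-] k.
have oA : open (c_set (cyl_chart c) U) by exact: c_set_open.
have sl : smooth (c_set (cyl_chart c) U) (fun y : 'rV[R]_(1 + n) => lsubmx y 0 0).
  by apply: smooth_coord => //; exact/smooth_lin/continuous_lsubmx.
exact: Ck_comp1 oA (sl k) (sf k).
Qed.

Definition slice X (t : R) : vfield N := fun x => rsubmx (X (t, x)).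

Definition slice_set U (t : R) : set N := [set x | U (t, x)].

Lemma open_slice U t : open U -> open (slice_set U t).
Proof.
move=> oU; apply: (open_comp (f := fun x => (t, x)) _ oU) => x _.
have c1 : {for x, continuous (fun _ : N => t)} by exact: cst_continuous.
have c2 : {for x, continuous (fun y : N => y)} by exact: cvg_id.
exact: (cvg_pair c1 c2).
Qed.

Lemma smooth_slice_map (A : set 'rV[R]_n) (t : R) : open A ->
  smooth A (fun y => row_mx t%:M y : 'rV[R]_(1 + n)).
Proof.
move=> oA; apply: smooth_row_mx => //; first exact: smooth_cst.
apply: (smooth_lin (L := @idfun 'rV[R]_n)) => //.
by move=> x; exact: cvg_id.
Qed.

Lemma cyl_inv_row c t y : cyl_inv c (row_mx t%:M y) = (t, c_inv c y).
Proof. by rewrite /cyl_inv row_mxKl row_mxKr mxE mulr1n. Qed.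

Lemma smooth_slice_fun U (h : M -> R) t : open U -> smooth_fun U h ->
  smooth_fun (slice_set U t) (fun x => h (t, x)).
Proof.
move=> oU sh c ac.
have oA : open (c_set c (slice_set U t)) by exact/c_set_open/open_slice.
apply: (smooth_ext (f := (h \o cyl_inv c) \o (fun y => row_mx t%:M y)) oA).
  by move=> y _; rewrite /= cyl_inv_row.
apply: (smooth_compr (B := c_set (cyl_chart c) U) oA).
- move=> y [cy Uy]; split; first by rewrite /= row_mxKr.
  by rewrite /preimage /= cyl_inv_row.
- exact: smooth_slice_map.
- exact: sh _ (cyl_atlasP ac).
Qed.

Lemma smooth_slice U X t : open U -> smooth_vfield U X ->
  smooth_vfield (slice_set U t) (slice X t).
Proof.
move=> oU sX c ac.
have oA : open (c_set c (slice_set U t)) by exact/c_set_open/open_slice.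
have oB : open (c_set (cyl_chart c) U) by exact: c_set_open.
apply: (smooth_ext (f := (cyl_comp c X \o cyl_inv c) \o (fun y => row_mx t%:M y)) oA).
  by move=> y _; rewrite /= cyl_inv_row.
apply: (smooth_comp oA oB).
- move=> y [cy Uy]; split; first by rewrite /= row_mxKr.
  by rewrite /preimage /= cyl_inv_row.
- exact: smooth_slice_map.
- exact: smooth_cyl_comp.
Qed.

Lemma cyl_comp_vdiff c U X p : open U -> atlas N c -> smooth_vfield U X ->
  c_dom c p.2 -> U p -> vdiff p (cyl_comp c X).
Proof.
move=> oU ac sX cp Up.
apply: (smooth_chart_vdiff (M := M) (c := cyl_chart c) (U := U) (cyl_atlasP ac)) => //.
exact: smooth_cyl_comp.
Qed.

(** The time derivative of the N-part of X.  With p.2 fixed the tangent space of N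
    is fixed too, so this does not depend on any choice. *)
Definition dtime X p : 'rV[R]_n := derive1 (fun s : R => rsubmx (X (s, p.2))) p.1.

Lemma derivable_slice U X p : open U -> smooth_vfield U X -> U p ->
  derivable (fun s : R => rsubmx (X (s, p.2))) p.1 1.
Proof.
move=> oU sX Up; have cp := chart_at_dom p.2; have ac := chart_at_atlas p.2.
have := derivable_time (cyl_comp_vdiff oU ac sX cp Up).
have -> // : (fun s : R => cyl_comp (chart_at p.2) X (s, p.2))
  = (fun s : R => rsubmx (X (s, p.2))).
by apply/funext => s; rewrite /cyl_comp /= vderiv_id.
Qed.

Lemma vderiv_dtime c U X p : open U -> atlas N c -> smooth_vfield U X ->
  c_dom c p.2 -> U p ->
  vderiv p.2 (dtime X p) c = derive1 (fun s : R => cyl_comp c X (s, p.2)) p.1.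
Proof.
move=> oU ac sX cp Up; have dX := derivable_slice oU sX Up.
rewrite derive1E /cyl_comp /= /vderiv derive_dir.
- by rewrite /dtime derive1E.
- exact: vdiff_atlas.
- exact/derivable1_diffP.
Qed.

End CylinderCalculus.

(** * Time derivatives of products and of mixed derivatives *)

Section Curves.
Variables (R : realType) (n : nat).
Implicit Types (F G : R -> 'rV[R]_n) (h : R -> R).

Lemma derive1_scaleD h F G t : derivable h t 1 -> derivable F t 1 -> derivable G t 1 ->
  derive1 (fun s => h s *: F s + G s) t
    = derive1 h t *: F t + h t *: derive1 F t + derive1 G t.
Proof.
move=> dh dF dG; rewrite !derive1E.
have /derivable_mxP dFij := dF; have /derivable_mxP dGij := dG.
have E i j : (fun s => (h s *: F s + G s) i j)
    = (h * (fun s => F s i j)) + (fun s => G s i j).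
  by apply/funext => s; rewrite !mxE.
have dm i j : derivable (h * (fun s => F s i j)) t 1.
  exact: derivableM dh (dFij i j).
have dE : derivable (fun s => h s *: F s + G s) t 1.
  apply/derivable_mxP => i j; rewrite E; exact: derivableD (dm i j) (dGij i j).
rewrite (derive_mx dE) (derive_mx dF) (derive_mx dG).
apply/matrixP => i j; rewrite [LHS]mxE E (deriveD (dm i j) (dGij i j)) (deriveM dh (dFij i j)) !mxE.
move: (F t i j) ('D_1 (fun s => F s i j) t) ('D_1 (fun s => G s i j) t) ('D_1 h t) (h t).
by move=> x x' y' a' a; rewrite /GRing.scale /=; ring.
Qed.

Lemma derive1_linear (L : 'rV[R]_n -> 'rV[R]_n) F t : linear L -> derivable F t 1 ->
  derive1 (fun s => L (F s)) t = L (derive1 F t).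
Proof.
move=> /linear_mulmx[B ->] dF; rewrite !derive1E.
have dF' : differentiable F t by exact/derivable1_diffP.
exact: (derive_linl (L := mulmxr B) _ (@continuous_mulmxr R 1 n n B) dF').
Qed.

Lemma linear_big (V W : lmodType R) (L : V -> W) m (a : 'I_m -> R) (v : 'I_m -> V) :
  linear L -> L (\sum_i a i *: v i) = \sum_i a i *: L (v i).
Proof.
move=> lL; elim/big_rec2: _ => [|i y1 y2 _ <-]; last exact: lL.
by have := lL (-1) 0 0; rewrite scaleN1r oppr0 addr0 scaleN1r addNr.
Qed.

Lemma bilinear_big (B : 'rV[R]_n -> 'rV[R]_n -> R) m (a b : 'I_m -> R)
    (v w : 'I_m -> 'rV[R]_n) :
  (forall u, scalar (B u)) -> (forall u u', B u u' = B u' u) ->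
  B (\sum_i a i *: v i) (\sum_i b i *: w i)
    = \sum_i \sum_j a i * b j * B (v i) (w j).
Proof.
move=> lB sB; rewrite sB (linear_big (W := R^o) _ _ (lB _)).
apply: eq_bigr => i _; rewrite sB (linear_big (W := R^o) _ _ (lB _)) scaler_sumr.
by apply: eq_bigr => j _; rewrite /GRing.scale /= mulrA.
Qed.

Lemma bilinear_sumE (B : 'rV[R]_n -> 'rV[R]_n -> R) u v :
  (forall w, scalar (B w)) -> (forall w w', B w w' = B w' w) ->
  B u v = \sum_i \sum_j u 0 i * v 0 j * B (delta_mx 0 i) (delta_mx 0 j).
Proof.
move=> lB sB; rewrite {1}(row_sum_delta u) {1}(row_sum_delta v).
exact: (bilinear_big (fun i => u 0 i) (fun j => v 0 j)).
Qed.

Lemma derive1_bilinear (B : 'rV[R]_n -> 'rV[R]_n -> R) F G t :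
  (forall w, scalar (B w)) -> (forall w w', B w w' = B w' w) ->
  derivable F t 1 -> derivable G t 1 ->
  derive1 (fun s => B (F s) (G s)) t = B (derive1 F t) (G t) + B (F t) (derive1 G t).
Proof.
move=> lB sB dF dG; rewrite !derive1E.
have /derivable_mxP dFij := dF; have /derivable_mxP dGij := dG.
pose b i j := B (delta_mx 0 i) (delta_mx 0 j).
have -> : (fun s => B (F s) (G s))
    = \sum_i \sum_j ((fun s => F s 0 i) * (fun s => G s 0 j)) * cst (b i j).
  apply/funext => s; rewrite bilinear_sumE// fct_sumE; apply: eq_bigr => i _.
  by rewrite fct_sumE.
have dij i j : derivable (((fun s => F s 0 i) * (fun s => G s 0 j)) * cst (b i j)) t 1.
  exact: derivableM (derivableM (dFij 0 i) (dGij 0 j)) (derivable_cst _ _ _).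
rewrite derive_sum; last by move=> i; exact: derivable_sum (dij i).
rewrite !(bilinear_sumE _ _ lB sB) -big_split; apply: eq_bigr => i _ /=.
rewrite (derive_sum (dij i)) -big_split; apply: eq_bigr => j _ /=.
rewrite (deriveM (derivableM (dFij 0 i) (dGij 0 j)) (derivable_cst _ _ _)).
rewrite (deriveM (dFij 0 i) (dGij 0 j)) derive_cst (derive_mx dF) (derive_mx dG) !mxE /cst /b /=.
move: (F t 0 i) (G t 0 j) ('D_1 (fun s => F s 0 i) t) ('D_1 (fun s => G s 0 j) t) (B _ _).
by move=> x y x' y' z; rewrite /GRing.scale /=; ring.
Qed.

End Curves.

Section TimeDerivatives.
Variables (R : realType) (n : nat) (N : manifold R n).
Let M := cylinder N.
Implicit Types (p q : M) (U : set M) (X Y Z : vfield M) (c : chart R N n).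

Lemma cyl_cfield c (a : 'M[R]_1) (w : 'rV[R]_n) p : atlas N c -> c_dom c p.2 ->
  cfield (M := M) (cyl_chart c) (row_mx a w) p = row_mx a (cfield c w p.2).
Proof.
move=> ac cp; have := cfieldK (M := M) (row_mx a (cfield c w p.2)) (cyl_atlasP ac) cp.
by rewrite (cyl_vderiv_chart _ ac cp) row_mxKl row_mxKr vderiv_cfield.
Qed.

Lemma vderiv_sumr p u (I : Type) (r : seq I) (h : I -> M -> R) :
  (forall i, vdiff p (h i)) ->
  vderiv p u (fun q => \sum_(i <- r) h i q) = \sum_(i <- r) vderiv p u (h i)
  /\ vdiff p (fun q => \sum_(i <- r) h i q).
Proof.
move=> dh; elim: r => [|i r [IH dr]].
  rewrite big_nil; under [X in vderiv _ _ X]funext do rewrite big_nil.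
  under [X in vdiff _ X]funext do rewrite big_nil.
  by split; [exact: derive_cst|exact: differentiable_cst].
rewrite big_cons; under [X in vderiv _ _ X]funext do rewrite big_cons.
under [X in vdiff _ X]funext do rewrite big_cons.
by split; [rewrite vderivD// IH|exact: vdiffD].
Qed.

(** Derivations along this field are the derivations along the slices, cf.
    [vderiv_horizontal]. *)
Lemma smooth_horizontal U X : open U -> smooth_vfield U X ->
  smooth_vfield U (fun q : M => row_mx 0 (rsubmx (X q)) : 'rV[R]_(1 + n)).
Proof.
move=> oU sX; apply: (cyl_smoothP oU).
  have -> : (fun p : M => cyl_eta p (row_mx 0 (rsubmx (X p)))) = fun=> 0.
    by apply/funext => p; rewrite /cyl_eta row_mxKl mxE.
  exact: smooth_fun_cst.
move=> c ac; have -> : cyl_comp c (fun q : M => row_mx 0 (rsubmx (X q)) : 'rV_(1 + n))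
    = cyl_comp c X.
  by apply/funext => q; rewrite /cyl_comp row_mxKr.
exact: smooth_cyl_comp.
Qed.

Lemma slice_setP U p : U p -> slice_set U p.1 p.2.
Proof. by case: p. Qed.

Lemma smooth_xi U : open U -> smooth_vfield U (@cyl_xi R n N).
Proof.
move=> oU; apply: (cyl_smoothP oU).
  have -> : (fun p : M => cyl_eta p (cyl_xi p)) = fun=> 1.
    by apply/funext => p; rewrite /cyl_eta row_mxKl mxE.
  exact: smooth_fun_cst.
move=> c ac; have -> : cyl_comp c (@cyl_xi R n N) = fun=> 0.
  by apply/funext => q; rewrite /cyl_comp row_mxKr /vderiv derive0.
have oA : open (c_set (cyl_chart c) U) by exact: c_set_open.
by apply: (smooth_ext (f := fun=> 0) oA) => [y _|]; [|exact: smooth_cst].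
Qed.

Lemma smooth_dt U h : open U -> smooth_fun U h ->
  smooth_fun U (fun q : M => derive1 (fun s => h (s, q.2)) q.1).
Proof.
move=> oU sh; have -> : (fun q : M => derive1 (fun s => h (s, q.2)) q.1)
    = (fun q => vderiv q (cyl_xi q) h).
  by apply/funext => q; rewrite vderiv_xi.
exact: smooth_vderiv oU (smooth_xi oU) sh.
Qed.

(** d/dt (Y'_t(h_t)) = (dY'/dt)(h_t) + Y'_t(dh/dt).  Write Y' = sum_j Y^j e_j in a chart
    of N and use the product rule: e_j and d/dt are coordinate fields of the
    cylinder, so they commute. *)
Lemma time_vderiv U Y h p : open U -> smooth_vfield U Y -> smooth_fun U h -> U p ->
  derive1 (fun s : R => vderiv p.2 (rsubmx (Y (s, p.2))) (fun x => h (s, x))) p.1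
  = vderiv p.2 (dtime Y p) (fun x => h (p.1, x))
    + vderiv p.2 (rsubmx (Y p)) (fun x => derive1 (fun s => h (s, x)) p.1).
Proof.
move=> oU sY sh Up; have ac := chart_at_atlas p.2; have cp := chart_at_dom p.2.
set c := chart_at p.2 in ac cp *; pose C : chart R M (1 + n) := cyl_chart c.
pose V : set M := U `&` c_dom C.
have oV : open V by exact: openI oU (c_dom_open C).
have Vp : V p by [].
have aC : atlas M C by exact: cyl_atlasP.
pose E j : vfield M := cfield C (row_mx 0 (delta_mx 0 j)).
have sE j : smooth_vfield V (E j).
  by apply: smooth_vfield_sub (smooth_cfield _ aC) => ? [].
have shV : smooth_fun V h by apply: smooth_fun_sub sh => ? [].
have sEh j := smooth_vderiv oV (sE j) shV.
pose k j (q : M) : R := cyl_comp c Y q 0 j.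
have dk j : vdiff p (k j).
  apply: (smooth_chart_vdiff (M := M) (c := C) (U := U) aC _ cp Up).
  exact: (smooth_coord (F := cyl_comp c Y \o cyl_inv c) 0 j (c_set_open (c := C) oU)
    (smooth_cyl_comp oU ac sY)).
have dEh j := smooth_vdiff (sEh j) Vp.
have -> : (fun s : R => vderiv p.2 (rsubmx (Y (s, p.2))) (fun x => h (s, x)))
  = (fun s : R => vderiv (M := M) (s, p.2) (row_mx 0 (rsubmx (Y (s, p.2)))) h).
  by apply/funext => s; rewrite vderiv_horizontal.
rewrite -(vderiv_xi (fun q : M => vderiv q (row_mx 0 (rsubmx (Y q))) h)).
rewrite (vderiv_near _ (h' := fun q => \sum_j k j q * vderiv q (E j q) h) oV Vp); last first.
  move=> q [Uq cq].
  rewrite vderiv_horizontal {1}(vfield_expand (rsubmx (Y q)) ac cq).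
  rewrite vderiv_sumE; last first.
    exact: smooth_vdiff (smooth_slice_fun q.1 oU sh) (slice_setP Uq).
  by apply: eq_bigr => j _; rewrite /E (cyl_cfield _ _ ac cq) vderiv_horizontal.
rewrite (vderiv_sumr _ _ (fun j => vdiffM (dk j) (dEh j))).1.
under eq_bigr => j _ do rewrite (vderivM _ (dk j) (dEh j)).
have Uslice := slice_setP Up.
rewrite big_split /= addrC; congr (_ + _).
  rewrite [dtime Y p in RHS](vfield_expand _ ac cp) vderiv_sumE; last first.
    exact: smooth_vdiff (smooth_slice_fun p.1 oU sh) Uslice.
  apply: eq_bigr => j _; rewrite /E (cyl_cfield _ _ ac cp) vderiv_horizontal mulrC.
  rewrite (vderiv_dtime oU ac sY cp Up) -vderiv_xi vderiv_coord//.
  exact: cyl_comp_vdiff oU ac sY cp Up.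
rewrite [rsubmx (Y p) in RHS](vfield_expand _ ac cp) vderiv_sumE; last first.
  exact: smooth_vdiff (smooth_slice_fun p.1 oU (smooth_dt oU sh)) Uslice.
(* d/dt is the coordinate field of the first coordinate in every product chart *)
have xiE (q : M) : c_dom c q.2 -> cyl_xi q = cfield (M := M) C (row_mx 1%:M 0) q.
  by move=> cq; rewrite (cyl_cfield _ _ ac cq) /cfield derive0.
apply: eq_bigr => j _; apply: (congr1 ( *%R (k j p))).
rewrite (xiE _ cp) (cfield_comm (M := M) _ _ aC oU sh Up cp).
rewrite (vderiv_near _ (h' := fun q => vderiv q (cyl_xi q) h) oV Vp); last first.
  by move=> q [_ cq]; rewrite (xiE q cq).
rewrite (cyl_cfield _ _ ac cp) vderiv_horizontal; congr vderiv.
by apply/funext => x; rewrite vderiv_xi.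
Qed.

Lemma dtimeZD U h X Y p : open U -> smooth_fun U h -> smooth_vfield U X ->
  smooth_vfield U Y -> U p ->
  dtime (fun q => h q *: X q + Y q) p
  = derive1 (fun s => h (s, p.2)) p.1 *: rsubmx (X p) + h p *: dtime X p + dtime Y p.
Proof.
move=> oU sh sX sY Up; rewrite /dtime.
have -> : (fun s => rsubmx (h (s, p.2) *: X (s, p.2) + Y (s, p.2)))
    = (fun s => h (s, p.2) *: rsubmx (X (s, p.2)) + rsubmx (Y (s, p.2))).
  by apply/funext => s; rewrite linearP.
rewrite derive1_scaleD -?surjective_pairing//.
- exact: derivable_time (smooth_vdiff sh Up).
- exact: derivable_slice oU sX Up.
- exact: derivable_slice oU sY Up.
Qed.

Lemma cyl_etaP p a (u v : 'rV[R]_(1 + n)) : cyl_eta p (a *: u + v) = a * cyl_eta p u + cyl_eta p v.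
Proof. by rewrite /cyl_eta !mxE. Qed.

Lemma cyl_etaD p (u v : 'rV[R]_(1 + n)) : cyl_eta p (u + v) = cyl_eta p u + cyl_eta p v.
Proof. by rewrite /cyl_eta !mxE. Qed.

Lemma cyl_etaB p (u v : 'rV[R]_(1 + n)) : cyl_eta p (u - v) = cyl_eta p u - cyl_eta p v.
Proof. by rewrite /cyl_eta !mxE. Qed.

Lemma cyl_etaZ p a (u : 'rV[R]_(1 + n)) : cyl_eta p (a *: u) = a * cyl_eta p u.
Proof. by rewrite /cyl_eta !mxE. Qed.

Lemma cyl_eta_row p a (w : 'rV[R]_n) : cyl_eta p (row_mx a%:M w) = a.
Proof. by rewrite /cyl_eta row_mxKl mxE mulr1n. Qed.

Lemma cyl_ext p (u v : 'rV[R]_(1 + n)) : cyl_eta p u = cyl_eta p v -> rsubmx u = rsubmx v -> u = v.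
Proof. by move=> e1 e2; rewrite (cyl_split p u) (cyl_split p v) e1 e2. Qed.

End TimeDerivatives.

(** * The Levi-Civita connection of the warped product *)

Section VectorIdentities.
Variables (R : realType) (n : nat).
Implicit Types (a b h k : R) (d u v x y : 'rV[R]_n).

Lemma warped_identity_l a a' b h k d u u' x x' y :
  (h * a + a') *: d + (h *: u + u') + k *: ((h * a + a') *: y + b *: (h *: x + x'))
  = h *: (a *: d + u + k *: (a *: y + b *: x)) + (a' *: d + u' + k *: (a' *: y + b *: x')).
Proof. by apply/rowP => i; rewrite !mxE; ring. Qed.

Lemma warped_identity_r a b b' k d d' u u' x y y' :
  a *: (d + d') + (u + u') + k *: (a *: (y + y') + (b + b') *: x)
  = a *: d + u + k *: (a *: y + b *: x) + (a *: d' + u' + k *: (a *: y' + b' *: x)).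
Proof. by apply/rowP => i; rewrite !mxE; ring. Qed.

Lemma warped_identity_leibniz a b h k ht hx d u x y :
  a *: (ht *: y + h *: d) + (hx *: y + h *: u) + k *: (a *: (h *: y) + (h * b) *: x)
  = (a * ht + hx) *: y + h *: (a *: d + u + k *: (a *: y + b *: x)).
Proof. by apply/rowP => i; rewrite !mxE; ring. Qed.

Lemma warped_identity_torsion a b k d d' u u' x y :
  a *: d + u + k *: (a *: y + b *: x) - (b *: d' + u' + k *: (b *: x + a *: y))
  = a *: d + ((- b) *: d' + (u - u')).
Proof. by apply/rowP => i; rewrite !mxE; ring. Qed.

Lemma torsion_scalar_identity a b Xb Ya D DD D1 D2 XY YX XD YD :
  (Xb - Ya) * D + (a * D1 + (- b * D2 + (XY - YX)))
  = b * (a * DD + XD) + D * Xb + (a * (D1 + YD) + XY)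
    - (a * (b * DD + YD) + D * Ya + (b * (D2 + XD) + YX)) :> R.
Proof. by ring. Qed.

Lemma metric_scalar_identity (a b c Xb Xc F F' gXY gXZ gYZ g1 g2 g3 g4 : R) : F != 0 ->
  b * Xc + c * Xb + (F * F * (a * (g1 + g2) + (g3 + g4))
     + gYZ * (F * (a * F') + F * (a * F')))
  = (Xb - F * F' * gXY) * c + F ^+ 2 * (a * g1 + g3 + F' / F * (a * gYZ + b * gXZ))
    + (b * (Xc - F * F' * gXZ) + F ^+ 2 * (a * g2 + g4 + F' / F * (a * gYZ + c * gXY))).
Proof. by move=> F0; field. Qed.

Lemma rsubmxP a (u v : 'rV[R]_(1 + n)) : rsubmx (a *: u + v) = a *: rsubmx u + rsubmx v.
Proof. exact: linearP. Qed.

Lemma rsubmxD (u v : 'rV[R]_(1 + n)) : rsubmx (u + v) = rsubmx u + rsubmx v.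
Proof. exact: linearD. Qed.

Lemma rsubmxZ a (u : 'rV[R]_(1 + n)) : rsubmx (a *: u) = a *: rsubmx u.
Proof. exact: linearZ. Qed.

End VectorIdentities.

Section WarpedConnection.
Variables (R : realType) (n : nat) (N : manifold R n).
Variable g : N -> 'rV[R]_n -> 'rV[R]_n -> R.
Variables (nabla : vfield N -> vfield N -> vfield N) (f : R -> R).
Hypothesis gmetric : riemannian_metric g.
Hypothesis gnabla : levi_civita g nabla.
Hypothesis fsmooth : smooth setT f.
Hypothesis fpos : forall t, 0 < f t.
Let M := cylinder N.
Implicit Types (p q : M) (U : set M) (X Y Z : vfield M) (c : chart R N n).

Let glin x u : scalar (g x u). Proof. by case: gmetric. Qed.
Let gsym x u v : g x u v = g x v u. Proof. by case: gmetric. Qed.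
Let gr x a u v w : g x w (a *: u + v) = a * g x w u + g x w v.
Proof. by case: gmetric => ->. Qed.
Let gl x a u v w : g x (a *: u + v) w = a * g x u w + g x v w.
Proof. by rewrite gsym gr !(gsym _ w). Qed.
Let cnabla : connection nabla. Proof. by case: gnabla. Qed.

Lemma frame_expand c X q : atlas N c -> c_dom c q.2 ->
  rsubmx (X q) = \sum_i cyl_comp c X q 0 i *: cfield c (delta_mx 0 i) q.2.
Proof. by move=> ac cq; exact: vfield_expand. Qed.

Lemma smooth_funD U (h h' : M -> R) : open U -> smooth_fun U h -> smooth_fun U h' ->
  smooth_fun U (fun p => h p + h' p).
Proof.
move=> oU sh sh' c ac; have oA : open (c_set c U) by exact: c_set_open.
exact: smoothD oA (sh c ac) (sh' c ac).
Qed.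

(** The metric of N is only known to be smooth on fields of N, whereas X' and Y'
    depend on t; expanding in a frame of N separates the two variables. *)
Lemma smooth_gpart U X Y : open U -> smooth_vfield U X -> smooth_vfield U Y ->
  smooth_fun U (fun q => g q.2 (rsubmx (X q)) (rsubmx (Y q))).
Proof.
move=> oU sX sY _ [c ac <-]; have oA : open (c_set (cyl_chart c) U) by exact: c_set_open.
have [_ _ _ gs] := gmetric; have oD := c_dom_open c.
pose e i : vfield N := cfield c (delta_mx 0 i).
have se i : smooth_vfield (c_dom c) (e i) by exact: smooth_cfield.
have sXc i := smooth_coord 0 i oA (smooth_cyl_comp oU ac sX).
have sYc i := smooth_coord 0 i oA (smooth_cyl_comp oU ac sY).
have sg i j := smooth_pull oU ac (gs _ _ _ oD (se i) (se j)).
have S : smooth (c_set (cyl_chart c) U) (fun y => \sum_i \sum_j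
    (cyl_comp c X \o cyl_inv c) y 0 i * (cyl_comp c Y \o cyl_inv c) y 0 j *
    ((fun p : M => g p.2 (e i p.2) (e j p.2)) \o cyl_inv c) y).
  apply: (smooth_sum _ oA) => i; apply: (smooth_sum _ oA) => j.
  exact: smoothM oA (smoothM oA (sXc i) (sYc j)) (sg i j).
apply: (smooth_ext oA _ S) => y /cyl_setE [cy Uy].
rewrite [RHS]/= (frame_expand X ac cy) (frame_expand Y ac cy).
by rewrite bilinear_big.
Qed.

Lemma sliceE X p : slice X p.1 p.2 = rsubmx (X p).
Proof. by case: p. Qed.

Definition warped_conn X Y : vfield M := fun p =>
  row_mx (vderiv p (X p) (fun q => cyl_eta q (Y q))
      - f p.1 * derive1 f p.1 * g p.2 (rsubmx (X p)) (rsubmx (Y p)))%:M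
    (cyl_eta p (X p) *: dtime Y p + nabla (slice X p.1) (slice Y p.1) p.2
     + (derive1 f p.1 / f p.1) *:
       (cyl_eta p (X p) *: rsubmx (Y p) + cyl_eta p (Y p) *: rsubmx (X p))).

Let f0 t : f t != 0. Proof. by rewrite gt_eqF. Qed.

Lemma smooth_warp_derive : smooth setT (derive1 f).
Proof.
have -> : derive1 f = 'D_1 f by apply/funext => t; rewrite derive1E.
exact: smooth_derive.
Qed.

Lemma smooth_log_derive : smooth setT (fun t => derive1 f t / f t).
Proof.
have oT : open [set: R] by exact: openT.
apply: (smoothM oT smooth_warp_derive); apply: (smoothV oT _ fsmooth) => t _.
exact: f0.
Qed.

(** The time and slice terms of [warped_conn] combine into the derivative along X of
    the components of Y, leaving only Christoffel symbols, which do not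
    depend on t. *)
Lemma warped_conn_comp c U X Y p : open U -> atlas N c -> smooth_vfield U X ->
  smooth_vfield U Y -> c_dom c p.2 -> U p ->
  cyl_comp c (warped_conn X Y) p = vderiv p (X p) (cyl_comp c Y)
    + \sum_i \sum_j (cyl_comp c X p 0 i * cyl_comp c Y p 0 j) *:
        vderiv p.2 (nabla (cfield c (delta_mx 0 i)) (cfield c (delta_mx 0 j)) p.2) c
    + (derive1 f p.1 / f p.1) *:
        (cyl_eta p (X p) *: cyl_comp c Y p + cyl_eta p (Y p) *: cyl_comp c X p).
Proof.
move=> oU ac sX sY cp Up; have dc := vdiff_atlas ac cp.
rewrite {1}/cyl_comp row_mxKr (vderivDl _ _ dc) (vderivDl _ _ dc).
rewrite !(vderivZl _ _ dc) (vderivDl _ _ dc) !(vderivZl _ _ dc).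
congr (_ + _); rewrite (vderiv_dtime oU ac sY cp Up).
have oS := open_slice p.1 oU.
rewrite (conn_chart cnabla ac oS (smooth_slice p.1 oU sX)
  (smooth_slice p.1 oU sY) (slice_setP Up) cp).
rewrite (cyl_vderivE _ (cyl_comp_vdiff oU ac sY cp Up)) !sliceE.
exact: (addrA (_ : 'rV[R]_n)).
Qed.

Lemma smooth_warped_conn U X Y : open U -> smooth_vfield U X -> smooth_vfield U Y ->
  smooth_vfield U (warped_conn X Y).
Proof.
move=> oU sX sY.
have seX := smooth_eta oU sX; have seY := smooth_eta oU sY.
apply: (cyl_smoothP oU).
  have sf := smooth_time oU fsmooth; have sf' := smooth_time oU smooth_warp_derive.
  have S := smooth_funD oU (smooth_vderiv oU sX seY) (smooth_funM oU
    (smooth_fun_cst (-1) oU) (smooth_funM oU (smooth_funM oU sf sf') (smooth_gpart oU sX sY))).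
  move=> c ac; apply: (smooth_ext (c_set_open oU) _ (S c ac)) => y _.
  by rewrite /= cyl_eta_row mulN1r.
move=> c ac; have oA : open (c_set (cyl_chart c) U) by exact: c_set_open.
have sXv := smooth_cyl_comp oU ac sX; have sYv := smooth_cyl_comp oU ac sY.
have sXc i := smooth_coord 0 i oA sXv; have sYc i := smooth_coord 0 i oA sYv.
pose e i : vfield N := cfield c (delta_mx 0 i).
have oD := c_dom_open c; have aC : atlas M (cyl_chart c) by exact: cyl_atlasP.
have se i : smooth_vfield (c_dom c) (e i) by exact: smooth_cfield.
have sG i j := smooth_pullv oU ac (conn_smooth cnabla oD (se i) (se j) ac).
have S1 := smooth_derive_dir oA (sX _ aC) sYv.
have S2 : smooth (c_set (cyl_chart c) U) (fun y => \sum_i \sum_j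
    ((cyl_comp c X \o cyl_inv c) y 0 i * (cyl_comp c Y \o cyl_inv c) y 0 j) *:
    ((fun p : M => vderiv p.2 (nabla (e i) (e j) p.2) c) \o cyl_inv c) y).
  apply: (smooth_sum _ oA) => i; apply: (smooth_sum _ oA) => j.
  exact: smooth_scale oA (smoothM oA (sXc i) (sYc j)) (sG i j).
have S3 := smooth_scale oA (smooth_time oU smooth_log_derive aC)
  (smoothD oA (smooth_scale oA (seX _ aC) sYv) (smooth_scale oA (seY _ aC) sXv)).
apply: (smooth_ext oA _ (smoothD oA (smoothD oA S1 S2) S3)) => y Ay.
have [cy Uy] := cyl_setE Ay; have [yC _] := Ay.
have dY : differentiable (cyl_comp c Y \o cyl_inv c) y by exact: smooth_diff sYv Ay.
have yE : cyl_chart c (cyl_inv c y) = y by exact: (c_invK yC).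
have vE : vderiv (cyl_inv c y : M) (X (cyl_inv c y)) (cyl_comp c Y)
    = 'D_(vderiv (cyl_inv c y : M) (X (cyl_inv c y)) (cyl_chart c)) (cyl_comp c Y \o cyl_inv c) y.
  rewrite [LHS](vderiv_chart (M := M) (c := cyl_chart c) _ aC cy); first by rewrite yE.
  by rewrite yE.
by rewrite [RHS]/= (warped_conn_comp oU ac sX sY cy Uy) vE.
Qed.

Lemma warped_conn_eta X Y p : cyl_eta p (warped_conn X Y p)
  = vderiv p (X p) (fun q => cyl_eta q (Y q))
    - f p.1 * derive1 f p.1 * g p.2 (rsubmx (X p)) (rsubmx (Y p)).
Proof. exact: cyl_eta_row. Qed.

Lemma warped_conn_N X Y p : rsubmx (warped_conn X Y p)
  = cyl_eta p (X p) *: dtime Y p + nabla (slice X p.1) (slice Y p.1) p.2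
    + (derive1 f p.1 / f p.1) *:
      (cyl_eta p (X p) *: rsubmx (Y p) + cyl_eta p (Y p) *: rsubmx (X p)).
Proof. exact: row_mxKr. Qed.

Lemma eta_vdiff U X p : open U -> smooth_vfield U X -> U p ->
  vdiff p (fun q : M => cyl_eta q (X q)).
Proof. by move=> oU sX Up; exact: smooth_vdiff (smooth_eta oU sX) Up. Qed.

Lemma warped_connZDl U X X' Y h p : open U -> smooth_vfield U X ->
  smooth_vfield U X' -> smooth_vfield U Y -> smooth_fun U h -> U p ->
  warped_conn (fun q => h q *: X q + X' q) Y p = h p *: warped_conn X Y p + warped_conn X' Y p.
Proof.
move=> oU sX sX' sY sh Up; apply: (cyl_ext (p := p)).
  rewrite cyl_etaP !warped_conn_eta rsubmxP gl (vderivP _ _ _ (eta_vdiff oU sY Up)).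
  by rewrite /GRing.scale /=; ring.
rewrite !rsubmxP !warped_conn_N rsubmxP cyl_etaP.
have -> : slice (fun q => h q *: X q + X' q) p.1
    = (fun x => h (p.1, x) *: slice X p.1 x + slice X' p.1 x).
  by apply/funext => x; rewrite /slice rsubmxP.
rewrite (connZDl cnabla (open_slice p.1 oU) (smooth_slice p.1 oU sX)
  (smooth_slice p.1 oU sX') (smooth_slice p.1 oU sY) (smooth_slice_fun p.1 oU sh)
  (slice_setP Up)) -surjective_pairing.
exact: warped_identity_l.
Qed.

Lemma dtimeD U Y Y' p : open U -> smooth_vfield U Y -> smooth_vfield U Y' -> U p ->
  dtime (fun q => Y q + Y' q) p = dtime Y p + dtime Y' p.
Proof.
move=> oU sY sY' Up.
have := dtimeZD oU (smooth_fun_cst 1 oU) sY sY' Up.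
rewrite derive1_cst scale0r add0r scale1r.
by under [X in dtime X p = _]funext do rewrite scale1r.
Qed.

Lemma dtimeZ U h Y p : open U -> smooth_fun U h -> smooth_vfield U Y -> U p ->
  dtime (fun q => h q *: Y q) p
  = derive1 (fun s => h (s, p.2)) p.1 *: rsubmx (Y p) + h p *: dtime Y p.
Proof.
move=> oU sh sY Up.
have := dtimeZD oU sh sY (smooth_vfield0 (M := M) oU) Up.
under [X in dtime X p = _]funext do rewrite addr0.
have -> : dtime (fun _ : M => 0) p = 0; last by rewrite addr0.
rewrite /dtime; have -> : (fun s : R => rsubmx (0 : 'rV[R]_(1 + n))) = cst 0.
  by apply/funext => s; exact: linear0.
exact: derive1_cst.
Qed.

Lemma warped_connDr U X Y Y' p : open U -> smooth_vfield U X ->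
  smooth_vfield U Y -> smooth_vfield U Y' -> U p ->
  warped_conn X (fun q => Y q + Y' q) p = warped_conn X Y p + warped_conn X Y' p.
Proof.
move=> oU sX sY sY' Up; apply: (cyl_ext (p := p)).
  rewrite cyl_etaD !warped_conn_eta rsubmxD -[rsubmx (Y p) in LHS]scale1r gr mul1r.
  under [X in vderiv _ _ X]funext do rewrite cyl_etaD.
  rewrite (vderivD _ (eta_vdiff oU sY Up) (eta_vdiff oU sY' Up)); ring.
rewrite rsubmxD !warped_conn_N rsubmxD cyl_etaD (dtimeD oU sY sY' Up).
have -> : slice (fun q => Y q + Y' q) p.1
    = (fun x => slice Y p.1 x + slice Y' p.1 x).
  by apply/funext => x; rewrite /slice rsubmxD.
rewrite (connDr cnabla (open_slice p.1 oU) (smooth_slice p.1 oU sX)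
  (smooth_slice p.1 oU sY) (smooth_slice p.1 oU sY') (slice_setP Up)).
exact: warped_identity_r.
Qed.

Lemma warped_connZr U X Y h p : open U -> smooth_vfield U X ->
  smooth_vfield U Y -> smooth_fun U h -> U p ->
  warped_conn X (fun q => h q *: Y q) p = vderiv p (X p) h *: Y p + h p *: warped_conn X Y p.
Proof.
move=> oU sX sY sh Up.
apply: (cyl_ext (p := p)).
  rewrite cyl_etaP cyl_etaZ !warped_conn_eta rsubmxZ.
  have -> : g p.2 (rsubmx (X p)) (h p *: rsubmx (Y p)) = h p * g p.2 (rsubmx (X p)) (rsubmx (Y p)).
    have g0 : g p.2 (rsubmx (X p)) 0 = 0.
      by have := gr p.2 (-1) 0 0 (rsubmx (X p)); rewrite scaler0 addr0 mulN1r addNr.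
    by rewrite -[h p *: _]addr0 gr g0 addr0.
  under [X in vderiv _ _ X]funext do rewrite cyl_etaZ.
  rewrite (vderivM _ (smooth_vdiff sh Up) (eta_vdiff oU sY Up)); ring.
rewrite rsubmxP rsubmxZ !warped_conn_N rsubmxZ cyl_etaZ (dtimeZ oU sh sY Up).
have -> : slice (fun q => h q *: Y q) p.1
    = (fun x => h (p.1, x) *: slice Y p.1 x).
  by apply/funext => x; rewrite /slice rsubmxZ.
rewrite (connZr cnabla (open_slice p.1 oU) (smooth_slice p.1 oU sX)
  (smooth_slice p.1 oU sY) (smooth_slice_fun p.1 oU sh) (slice_setP Up)).
rewrite -surjective_pairing (cyl_vderivE _ (smooth_vdiff sh Up)) !sliceE.
exact: warped_identity_leibniz.
Qed.

Lemma warped_connection : connection warped_conn.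
Proof.
move=> U oU; split.
- by move=> X Y sX sY; exact: smooth_warped_conn.
- by move=> X X' Y h sX sX' sY sh p Up; exact: warped_connZDl oU sX sX' sY sh Up.
- by move=> X Y Y' sX sY sY' p Up; exact: warped_connDr oU sX sY sY' Up.
- by move=> X Y h sX sY sh p Up; exact: warped_connZr oU sX sY sh Up.
Qed.

Let dt (h : M -> R) : M -> R := fun q => derive1 (fun s => h (s, q.2)) q.1.

(** Expansion of X(Y h) for Y h = b dh/dt + Y'(h_t).  Exchanging X and Y and
    subtracting, all second derivatives involving t cancel. *)
Lemma second_vderiv U X Y h p : open U -> smooth_vfield U X -> smooth_vfield U Y ->
  smooth_fun U h -> U p ->
  vderiv p (X p) (fun q => vderiv q (Y q) h)
  = cyl_eta p (Y p) * (cyl_eta p (X p) * dt (dt h) p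
      + vderiv p.2 (rsubmx (X p)) (fun x => dt h (p.1, x)))
    + dt h p * vderiv p (X p) (fun q => cyl_eta q (Y q))
    + (cyl_eta p (X p) * (vderiv p.2 (dtime Y p) (fun x => h (p.1, x))
         + vderiv p.2 (rsubmx (Y p)) (fun x => dt h (p.1, x)))
       + vderiv p.2 (rsubmx (X p)) (fun x => vderiv x (slice Y p.1 x) (fun x' => h (p.1, x')))).
Proof.
move=> oU sX sY sh Up.
pose H q := vderiv q (row_mx 0 (rsubmx (Y q))) h.
have sH : smooth_fun U H by exact: smooth_vderiv oU (smooth_horizontal oU sY) sh.
have sdt : smooth_fun U (dt h) by exact: smooth_dt oU sh.
have seY := smooth_eta oU sY.
have dH := smooth_vdiff sH Up; have ddt := smooth_vdiff sdt Up.
have deY := smooth_vdiff seY Up.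
rewrite (vderiv_near _ (h' := fun q => cyl_eta q (Y q) * dt h q + H q) oU Up); last first.
  by move=> q Uq; rewrite (cyl_vderivE _ (smooth_vdiff sh Uq)) /H vderiv_horizontal.
rewrite (vderivD _ (vdiffM deY ddt) dH) (vderivM _ deY ddt).
congr (_ * _ + _ + _); first by rewrite (cyl_vderivE _ ddt).
rewrite (cyl_vderivE _ dH).
have -> : (fun s : R => H (s, p.2))
    = (fun s : R => vderiv p.2 (rsubmx (Y (s, p.2))) (fun x => h (s, x))).
  by apply/funext => s; rewrite /H vderiv_horizontal.
have -> : (fun x => H (p.1, x))
    = (fun x => vderiv x (slice Y p.1 x) (fun x' => h (p.1, x'))).
  by apply/funext => x; rewrite /H vderiv_horizontal.
by rewrite (time_vderiv oU sY sh Up).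
Qed.

(** On each slice this is the torsion freeness of nabla; the terms in f f' and f'/f
    are symmetric in X and Y and drop out. *)
Lemma warped_torsion_free : torsion_free warped_conn.
Proof.
have [_ tN _] := gnabla.
move=> U X Y h oU sX sY sh p Up.
have dh := smooth_vdiff sh Up.
have sht := smooth_slice_fun p.1 oU sh.
have dht := smooth_vdiff sht (slice_setP Up).
have TN := tN _ _ _ _ (open_slice p.1 oU) (smooth_slice p.1 oU sX)
  (smooth_slice p.1 oU sY) sht _ (slice_setP Up).
rewrite (second_vderiv oU sX sY sh Up) (second_vderiv oU sY sX sh Up).
rewrite (cyl_vderivE _ dh).
have -> : cyl_eta p (warped_conn X Y p - warped_conn Y X p)
    = vderiv p (X p) (fun q => cyl_eta q (Y q)) - vderiv p (Y p) (fun q => cyl_eta q (X q)).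
  rewrite cyl_etaB !warped_conn_eta (gsym _ (rsubmx (Y p))).
  by rewrite opprB addrA addrNK.
have -> : rsubmx (warped_conn X Y p - warped_conn Y X p)
    = cyl_eta p (X p) *: dtime Y p + ((- cyl_eta p (Y p)) *: dtime X p
      + (nabla (slice X p.1) (slice Y p.1) p.2 - nabla (slice Y p.1) (slice X p.1) p.2)).
  rewrite rsubmxD -scaleN1r rsubmxZ scaleN1r !warped_conn_N.
  exact: warped_identity_torsion.
rewrite (vderivP _ _ _ dht) (vderivP _ _ _ dht) TN !sliceE.
rewrite -/(dt h p) /GRing.scale /=.
exact: torsion_scalar_identity.
Qed.

(** Write a, b, c for the dt-components of X, Y, Z.  The term 2 a f f' g(Y', Z') of
    the derivative of f^2 g is matched by (f'/f) a Y' and (f'/f) a Z', while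
    (f'/f) b X' and (f'/f) c X' cancel the terms in f f' of the dt-components. *)
Lemma warped_metric_connection : metric_connection (warped_metric f g) warped_conn.
Proof.
have [_ _ mN] := gnabla.
move=> U X Y Z oU sX sY sZ p Up.
pose G (q : M) := g q.2 (rsubmx (Y q)) (rsubmx (Z q)).
pose F (q : M) := f q.1.
have sG : smooth_fun U G := smooth_gpart oU sY sZ.
have sF : smooth_fun U F := smooth_time oU fsmooth.
have dG := smooth_vdiff sG Up; have dF := smooth_vdiff sF Up.
have dY := eta_vdiff oU sY Up; have dZ := eta_vdiff oU sZ Up.
have FE : vderiv p (X p) F = cyl_eta p (X p) * derive1 f p.1.
  have F0 : vderiv p.2 (rsubmx (X p)) (fun x => F (p.1, x)) = 0.
    exact: (derive_cst (f p.1) (chart_at p.2 p.2) (rsubmx (X p))).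
  by rewrite (cyl_vderivE _ dF) F0 addr0.
have GE : vderiv p (X p) G = cyl_eta p (X p) *
      (g p.2 (dtime Y p) (rsubmx (Z p)) + g p.2 (rsubmx (Y p)) (dtime Z p))
    + (g p.2 (nabla (slice X p.1) (slice Y p.1) p.2) (rsubmx (Z p))
      + g p.2 (rsubmx (Y p)) (nabla (slice X p.1) (slice Z p.1) p.2)).
  rewrite (cyl_vderivE _ dG) -!sliceE.
  rewrite -(mN _ _ _ _ (open_slice p.1 oU) (smooth_slice p.1 oU sX)
    (smooth_slice p.1 oU sY) (smooth_slice p.1 oU sZ) _ (slice_setP Up)).
  congr (_ * _ + _); rewrite /G /=.
  rewrite (derive1_bilinear _ (gsym _) (derivable_slice oU sY Up) (derivable_slice oU sZ Up)).
    by case: p {Up dG dF dY dZ FE}.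
  by case: gmetric.
have -> : (fun q : M => warped_metric f g q (Y q) (Z q))
    = (fun q => cyl_eta q (Y q) * cyl_eta q (Z q) + F q * F q * G q).
  by apply/funext => q; rewrite /warped_metric expr2.
rewrite (vderivD _ (vdiffM dY dZ) (vdiffM (vdiffM dF dF) dG)).
rewrite (vderivM _ dY dZ) (vderivM _ (vdiffM dF dF) dG) (vderivM _ dF dF) FE GE.
rewrite /warped_metric !warped_conn_eta !warped_conn_N (gsym _ (rsubmx (Y p)) (_ + _)).
have gE k a b u1 u2 u3 u4 w : g p.2 (a *: u1 + u2 + k *: (a *: u3 + b *: u4)) w
    = a * g p.2 u1 w + g p.2 u2 w + k * (a * g p.2 u3 w + b * g p.2 u4 w).
  rewrite addrC gl addrC gl -[b *: u4 in LHS]addr0 gl gl.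
  have g0 : g p.2 0 w = 0.
    by have := gl p.2 (-1) 0 0 w; rewrite scaler0 addr0 mulN1r addNr.
  by rewrite g0 addr0.
rewrite !gE (gsym _ (dtime Z p)) (gsym _ _ (rsubmx (Y p))) (gsym _ (rsubmx (Z p)) (rsubmx (Y p))).
rewrite (gsym _ (nabla _ (slice Z p.1) _)) /G /F.
exact: metric_scalar_identity.
Qed.

Lemma warped_levi_civita : levi_civita (warped_metric f g) warped_conn.
Proof.
split; [exact: warped_connection|exact: warped_torsion_free|].
exact: warped_metric_connection.
Qed.

End WarpedConnection.

(** * The Kenmotsu structure *)

Section Kenmotsu.
Variables (R : realType) (n : nat) (N : manifold R n).
Variables (g : N -> 'rV[R]_n -> 'rV[R]_n -> R) (J : N -> 'rV[R]_n -> 'rV[R]_n).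
Variables (nabla : vfield N -> vfield N -> vfield N) (f : R -> R).
Hypothesis hN : locally_metallic g J nabla.
Hypothesis fsmooth : smooth setT f.
Hypothesis fpos : forall t, 0 < f t.
Let M := cylinder N.
Implicit Types (p q : M) (U : set M) (X Y Z : vfield M) (c : chart R N n).

Let gmetric : riemannian_metric g. Proof. by case: hN => -[]. Qed.
Let gnabla : levi_civita g nabla. Proof. by case: hN. Qed.
Let Jmetallic : metallic_structure J. Proof. by case: hN => -[]. Qed.
Let Jtensor : tensor11 J. Proof. by case: Jmetallic. Qed.
Let Jlin x : linear (J x). Proof. by case: Jtensor. Qed.
Let gsym x u v : g x u v = g x v u. Proof. by case: gmetric. Qed.
Let gr x a u v w : g x w (a *: u + v) = a * g x w u + g x w v.
Proof. by case: gmetric => ->. Qed.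
Let f0 t : f t != 0. Proof. by rewrite gt_eqF. Qed.

Let g0 x u : g x u 0 = 0.
Proof. by have := gr x (-1) 0 0 u; rewrite scaler0 addr0 mulN1r addNr. Qed.

Let J0 x : J x 0 = 0.
Proof. by have := Jlin x (-1) 0 0; rewrite scaler0 addr0 scaleN1r addNr. Qed.

Lemma warped_riemannian : riemannian_metric (warped_metric f g : M -> _).
Proof.
split.
- move=> p u a v w; rewrite /warped_metric cyl_etaP rsubmxP gr.
  by rewrite /GRing.scale /=; ring.
- by move=> p u v; rewrite /warped_metric gsym mulrC.
- move=> p u u0; rewrite /warped_metric -expr2.
  have [ru|ru] := eqVneq (rsubmx u) 0.
    rewrite ru g0 mulr0 addr0 exprn_even_gt0//=; apply: contra u0 => /eqP eu.
    by rewrite (cyl_split p u) eu ru scale0r add0r row_mx0.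
  apply: ltr_wpDl; first exact: sqr_ge0.
  apply: mulr_gt0; first by rewrite exprn_gt0.
  by case: gmetric => _ _ gpos _; exact: gpos.
- move=> U X Y oU sX sY.
  have sf := smooth_time oU fsmooth.
  have := smooth_funD oU (smooth_funM oU (smooth_eta oU sX) (smooth_eta oU sY))
    (smooth_funM oU (smooth_funM oU sf sf) (smooth_gpart gmetric oU sX sY)).
  by under [X in smooth_fun _ X]funext do rewrite -expr2.
Qed.

Lemma phi_eta p u : cyl_eta p (cyl_phi J p u) = 0.
Proof. by rewrite /cyl_eta /cyl_phi row_mxKl mxE. Qed.

Lemma phi_N p u : rsubmx (cyl_phi J p u) = J p.2 (rsubmx u).
Proof. exact: row_mxKr. Qed.

Lemma xi_eta p : cyl_eta p (@cyl_xi R n N p) = 1.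
Proof. by rewrite /cyl_eta /cyl_xi row_mxKl mxE. Qed.

Lemma xi_N p : rsubmx (@cyl_xi R n N p) = 0.
Proof. exact: row_mxKr. Qed.

(** As for the metric, J is only known to be smooth on fields of N, and a frame
    of N separates the variables. *)
Lemma smooth_Jpart c U X : open U -> atlas N c -> smooth_vfield U X ->
  smooth (c_set (cyl_chart c) U) (cyl_comp c (fun q => cyl_phi J q (X q)) \o cyl_inv c).
Proof.
move=> oU ac sX; have oA : open (c_set (cyl_chart c) U) by exact: c_set_open.
have [lJ sJ] := Jtensor; have oD := c_dom_open c.
pose e i : vfield N := cfield c (delta_mx 0 i).
have se i : smooth_vfield (c_dom c) (e i) by exact: smooth_cfield.
have sXc i := smooth_coord 0 i oA (smooth_cyl_comp oU ac sX).
have sJe i := smooth_pullv oU ac (sJ _ _ oD (se i) c ac).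
have S : smooth (c_set (cyl_chart c) U) (fun y => \sum_i
    (cyl_comp c X \o cyl_inv c) y 0 i *:
    ((fun p : M => vderiv p.2 (J p.2 (e i p.2)) c) \o cyl_inv c) y).
  by apply: (smooth_sum _ oA) => i; exact: smooth_scale oA (sXc i) (sJe i).
apply: (smooth_ext oA _ S) => y /cyl_setE [cy Uy].
rewrite [RHS]/= {2}/cyl_comp /cyl_phi row_mxKr (frame_expand X ac cy).
rewrite (linear_big _ _ (lJ _)) vderiv_sumE//.
exact: vdiff_atlas.
Qed.

Lemma smooth_phi U X : open U -> smooth_vfield U X ->
  smooth_vfield U (fun q => cyl_phi J q (X q)).
Proof.
move=> oU sX; apply: (cyl_smoothP oU).
  have -> : (fun p => cyl_eta p (cyl_phi J p (X p))) = fun=> 0.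
    by apply/funext => p; exact: phi_eta.
  exact: smooth_fun_cst.
by move=> c ac; exact: smooth_Jpart.
Qed.

Lemma phi_tensor : tensor11 (cyl_phi J : M -> _).
Proof.
split=> [p a u v|U X oU sX]; last exact: smooth_phi.
by rewrite /cyl_phi rsubmxP Jlin scale_row_mx add_row_mx scaler0 addr0.
Qed.

(** The polynomial relation of J on N becomes that of phi, as phi^2 kills xi; the
    constants a = p and b = q of the metallic structure are positive, so
    b and a^2 + 4 b are not zero. *)
Lemma warped_almost_quadratic :
  almost_quadratic_metric (warped_metric f g) (cyl_phi J) (@cyl_xi R n N) (@cyl_eta R n N).
Proof.
split.
- exact: warped_riemannian.
- split; [exact: phi_tensor|exact: smooth_xi openT|].
  split=> [p a u v|U X oU sX]; first exact: cyl_etaP.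
  exact: smooth_eta.
- move=> p; rewrite /warped_metric xi_eta xi_N g0 mulr0 addr0 mul1r; split=> //.
  by rewrite /cyl_phi xi_N J0 row_mx0.
- have [_ [a [b [a0 b0 JJ]]]] := Jmetallic.
  exists a%:R, b%:R; split.
  + by rewrite pnatr_eq0 -lt0n.
  + by rewrite gt_eqF// ltr_pwDr ?sqr_ge0// mulr_gt0 ?ltr0n.
  move=> p u; apply: (cyl_ext (p := p)).
    have -> : u - cyl_eta p u *: cyl_xi p = row_mx 0 (rsubmx u).
      by rewrite {1}(cyl_split p u) addrC addKr.
    have er w : cyl_eta p (row_mx 0 w) = 0 by rewrite /cyl_eta row_mxKl mxE.
    by rewrite phi_eta cyl_etaP phi_eta cyl_etaZ er !mulr0 addr0.
  have -> : u - cyl_eta p u *: cyl_xi p = row_mx 0 (rsubmx u).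
    by rewrite {1}(cyl_split p u) addrC addKr.
  by rewrite rsubmxP rsubmxZ !phi_N row_mxKr JJ.
- move=> p u v; rewrite /warped_metric !phi_eta !phi_N mul0r mulr0.
  by case: hN => -[_ _ ->].
Qed.

Lemma smooth_beta : smooth_fun setT (fun p : M => - derive1 f p.1 / f p.1).
Proof.
have oT : open [set: M] by exact: openT.
have := smooth_funM oT (smooth_fun_cst (-1) oT) (smooth_time oT (smooth_log_derive fsmooth fpos)).
by under [X in smooth_fun _ X]funext do rewrite mulN1r -mulNr.
Qed.

Lemma kenmotsu_identity (a b k : R) (d e x' y x u : 'rV[R]_n) : u = e ->
  a *: d + u + k *: (a *: y + 0 *: x') - (a *: d + e + k *: (a *: y + b *: x))
  = (- k) *: (b *: x).
Proof. by move=> ->; apply/rowP => i; rewrite !mxE; ring. Qed.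

(** At a fixed point of N, the tensor J is a fixed linear map. *)
Lemma dtime_phi U Y p : open U -> smooth_vfield U Y -> U p ->
  dtime (fun q => cyl_phi J q (Y q)) p = J p.2 (dtime Y p).
Proof.
move=> oU sY Up; rewrite /dtime.
have -> : (fun s : R => rsubmx (cyl_phi J ((s, p.2) : M) (Y (s, p.2))))
    = (fun s : R => J p.2 (rsubmx (Y (s, p.2)))).
  by apply/funext => s; rewrite phi_N.
exact: derive1_linear (Jlin _) (derivable_slice oU sY Up).
Qed.

(** Along N, d/dt commutes with J and nabla J = 0, so the only term of
    D_X (phi Y) - phi (D_X Y) left is - (f'/f) b J X'. *)
Lemma warped_conn_phi U X Y p : open U -> smooth_vfield U X -> smooth_vfield U Y -> U p ->
  cov_deriv11 (warped_conn g nabla f) (cyl_phi J) X Y p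
  = (- derive1 f p.1 / f p.1) *:
    (warped_metric f g p (X p) (cyl_phi J p (Y p)) *: cyl_xi p
     + cyl_eta p (Y p) *: cyl_phi J p (X p)).
Proof.
move=> oU sX sY Up; rewrite /cov_deriv11.
apply: (cyl_ext (p := p)).
  rewrite cyl_etaB cyl_etaZ cyl_etaP cyl_etaZ !phi_eta xi_eta warped_conn_eta phi_N.
  have -> : vderiv p (X p) (fun q : M => cyl_eta q (cyl_phi J q (Y q))) = 0.
    have -> : (fun q : M => cyl_eta q (cyl_phi J q (Y q))) = cst 0.
      by apply/funext => q; exact: phi_eta.
    exact: (derive_cst (0 : R) (chart_at p p) (X p)).
  rewrite /warped_metric phi_eta phi_N; move: (f0 p.1).
  move: (f p.1) (derive1 f p.1) (g _ _ _) (cyl_eta p _) => F F' G E F0.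
  by field.
rewrite rsubmxD -scaleN1r rsubmxZ scaleN1r phi_N !warped_conn_N.
rewrite rsubmxZ rsubmxP rsubmxZ xi_N scaler0 add0r !phi_N phi_eta (dtime_phi oU sY Up).
have JD x u v : J x (u + v) = J x u + J x v.
  by have := Jlin x 1 u v; rewrite !scale1r.
have JZ x k u : J x (k *: u) = k *: J x u.
  by have := Jlin x k u 0; rewrite J0 !addr0.
rewrite !JD !JZ JD !JZ mulNr.
apply: kenmotsu_identity.
have -> : slice (fun q => cyl_phi J q (Y q)) p.1 = (fun x => J x (slice Y p.1 x)).
  by apply/funext => x; rewrite /slice phi_N.
have [_ _ H] := hN.
have := H _ _ _ (open_slice p.1 oU) (smooth_slice p.1 oU sX)
  (smooth_slice p.1 oU sY) _ (slice_setP Up).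
by move/eqP; rewrite subr_eq0 => /eqP.
Qed.

End Kenmotsu.

Theorem theorem3p2 (R : realType) (n : nat) (N : manifold R n)
    (g : N -> 'rV[R]_n -> 'rV[R]_n -> R) (J : N -> 'rV[R]_n -> 'rV[R]_n)
    (nabla : vfield N -> vfield N -> vfield N) (f : R -> R)
    (hN : locally_metallic g J nabla)
    (hf : smooth setT f) (hf0 : forall t : R, 0 < f t) :
  (exists nablaM : vfield (cylinder N) -> vfield (cylinder N) -> vfield (cylinder N),
     levi_civita (warped_metric f g) nablaM) /\
  (forall nablaM : vfield (cylinder N) -> vfield (cylinder N) -> vfield (cylinder N),
     levi_civita (warped_metric f g) nablaM ->
     kenmotsu_quadratic_metric (warped_metric f g) nablaM
       (cyl_phi J) (@cyl_xi R n N) (@cyl_eta R n N)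
       (fun p : cylinder N => - derive1 f p.1 / f p.1)).
Proof.
have [[gm _ _] gn _] := hN.
have LC := warped_levi_civita gm gn hf hf0.
split; first by exists (warped_conn g nabla f).
move=> nablaM LCM; split.
- exact: warped_almost_quadratic hN hf hf0.
- exact: LCM.
- exact: smooth_beta.
move=> U X Y oU sX sY p Up.
have rm := warped_riemannian hN hf hf0.
rewrite -(warped_conn_phi hN hf0 oU sX sY Up) /cov_deriv11.
rewrite (levi_civita_unique rm LCM LC oU sX sY Up).
by rewrite (levi_civita_unique rm LCM LC oU sX (smooth_phi hN oU sY) Up).
Qed.
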